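(* For every $\varepsilon>0$ there exist $n_0$ and $\delta>0$ such that for every $n\ge n_0$, every graph on $n$ vertices with at most $\delta n^{5/2}$ copies of $C_5$ and at most $\delta n^2$ copies of $C_4$ can be made simultaneously $C_3$-free and $C_5$-free by deleting at most $\varepsilon n^{3/2}$ edges.
   Context: $C_k$ denotes the cycle on $k$ vertices ($C_3$ is the triangle); a copy of $C_k$ in a graph is a subgraph isomorphic to $C_k$. Equivalently: an $n$-vertex graph with $o(n^2)$ copies of $C_4$ and $o(n^{5/2})$ copies of $C_5$ can be made $\{C_3,C_5\}$-free by deleting $o(n^{3/2})$ edges. *)

(* Defs.v *)
From HB Require Import structures.
From mathcomp Require Import all_boot all_order all_algebra.
From mathcomp Require Import reals.
Set Implicit Arguments. Unset Strict Implicit. Unset Printing Implicit Defensive.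
Import Order.TTheory GRing.Theory Num.Theory.

Definition simple_graph (V : finType) (E : {set {set V}}) : Prop :=
  forall e, e \in E -> #|e| = 2.

Definition cycle_map (V : finType) (k : nat) (E : {set {set V}})
    (f : {ffun 'I_k -> V}) : bool :=
  injectiveb f && [forall i : 'I_k, [set f i; f (ordS i)] \in E].

Definition cyc_edges (V : finType) (k : nat) (f : {ffun 'I_k -> V})
  : {set {set V}} :=
  [set [set f i; f (ordS i)] | i : 'I_k].

(* The set of copies of C_k in E (k >= 3): a copy of C_k is a subgraph
   isomorphic to C_k, which (having no isolated vertices) is determined
   by its edge set. *)
Definition copies (V : finType) (k : nat) (E : {set {set V}})
  : {set {set {set V}}} :=
  [set cyc_edges f | f in [pred f : {ffun 'I_k -> V} | cycle_map E f]].

(* Main.v *)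
Require Import Defs.
From HB Require Import structures.
From mathcomp Require Import all_boot all_order all_algebra.
From mathcomp Require Import reals.
From mathcomp Require Import ring lra zify.
Set Implicit Arguments. Unset Strict Implicit. Unset Printing Implicit Defensive.
Import Order.TTheory GRing.Theory Num.Theory.
Local Open Scope ring_scope.

(** Let [n] be the number of vertices and [s = sqrt n]. Few copies of C_4 mean that the
    excess [sum_(x,y) (codeg x y - 1)] is o(n^2), so that after deleting the edges at few
    vertices all degrees are O(s) and the excess at every vertex is o(n). Consequently the
    block averages of [s] times the adjacency matrix are bounded in L^2, whatever the
    partition, and energy increments yield partitions [c0], [c1], with [c1] refining
    [c0], of almost equal energy such that the block averages of [c1] bound the graph
    from below in the cut sense, with an error tiny in terms of the size of [c0].

    Let [U] be the dense graph of the pairs whose [c1]-average is at least [u / s].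
    Deleting the edges in small, sparse or non-uniform pairs of [c0] costs few edges, and
    if a closed 5-walk survives (a triangle contains one too), its five classes in [c0]
    span at least [c n^5] closed 5-walks of [U]. The counting lemma transfers these
    to [c' n^(5/2)] closed 5-walks of the graph: a 5-cycle is an edge between two second
    neighbourhoods of a vertex, which are sets of linear size because codegrees are
    mostly at most 1, so the edges can be replaced by [U] one at a time. Only
    o(n^(5/2)) of the walks are degenerate, contradicting the few copies of C_5. *)

(** * Averages over the classes of a partition *)

Section Averaging.
Context (R : realFieldType).

(** Besides comparing partitions this expresses measurability: for a real-valued [a], [refines c a]
    makes [a] constant on the classes of [c]. *)
Definition refines (T : Type) (C C' : eqType) (c' : T -> C') (c : T -> C) :=
  forall t t', c' t = c' t' -> c t = c t'.

Definition avg (T : finType) (C : eqType) (c : T -> C) (h : T -> R) (t : T) : R :=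
  (\sum_(t' | c t' == c t) h t') / #|[pred t' | c t' == c t]|%:R.

Section Basics.
Context (T : finType) (C : eqType) (c : T -> C).
Implicit Types (a h : T -> R) (t : T).

Lemma class_card_gt0 t : 0 < #|[pred t' | c t' == c t]|%:R :> R.
Proof. by rewrite ltr0n; apply/card_gt0P; exists t; rewrite inE. Qed.

Lemma avg_refines h : refines c (avg c h).
Proof. by move=> t t' e; rewrite /avg e. Qed.

(** Averaging is a self-adjoint projection: in the double sum over pairs within a class it can be
    moved from [h] to [a], which it fixes. *)
Lemma sum_mul_avg a h : refines c a ->
  \sum_t a t * avg c h t = \sum_t a t * h t.
Proof.
move=> ac.
transitivity (\sum_t \sum_(t' | c t' == c t)
    a t * h t' / #|[pred x | c x == c t]|%:R).
  by apply: eq_bigr => t _; rewrite /avg mulrA mulr_sumr mulr_suml.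
rewrite (exchange_big_dep xpredT) //=; apply: eq_bigr => t' _.
transitivity (\sum_(t | c t == c t') a t' * h t' / #|[pred x | c x == c t']|%:R).
  apply: eq_big => [t|t /eqP e]; first by rewrite eq_sym.
  by rewrite (ac t t') // e.
rewrite sumr_const -[_ *+ _]mulr_natr divfK //.
by rewrite gt_eqF // class_card_gt0.
Qed.

Lemma sum_avg h : \sum_t avg c h t = \sum_t h t.
Proof.
have /= := @sum_mul_avg (fun=> 1) h (fun _ _ _ => erefl).
by under eq_bigr do rewrite mul1r; under [RHS]eq_bigr do rewrite mul1r.
Qed.

Lemma avg_ge0 h t : (forall t', 0 <= h t') -> 0 <= avg c h t.
Proof. by move=> h0; rewrite /avg divr_ge0 // sumr_ge0. Qed.

End Basics.

(** Pythagoras for two nested projections: the cross term equals the square of the coarser one. *)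
Lemma sum_sqr_avg_sub (T : finType) (C C' : eqType) (c : T -> C) (c' : T -> C')
    (h : T -> R) : refines c' c ->
  \sum_t (avg c' h t - avg c h t) ^+ 2 =
  \sum_t avg c' h t ^+ 2 - \sum_t avg c h t ^+ 2.
Proof.
move=> cc'.
have e : \sum_t avg c h t * avg c' h t = \sum_t avg c h t ^+ 2.
  rewrite sum_mul_avg; last by move=> t t' /cc'; apply: avg_refines.
  rewrite -(@sum_mul_avg _ _ c); last exact: avg_refines.
  by apply: eq_bigr => t _; rewrite expr2.
transitivity (\sum_t avg c' h t ^+ 2 + \sum_t avg c h t ^+ 2
              - 2 * \sum_t avg c h t * avg c' h t); last by rewrite e; ring.
rewrite mulr_sumr -big_split -sumrB /=.
by apply: eq_bigr => t _; ring.
Qed.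

End Averaging.

(** Cauchy-Schwarz against an indicator, by expanding a sum of squares. *)
Lemma sum_sqr_le (R : realFieldType) (T : finType) (P : pred T) (h : T -> R) :
  (\sum_(t | P t) h t) ^+ 2 <= #|T|%:R * \sum_t h t ^+ 2.
Proof.
set S := \sum_(t | P t) h t; set m := #|T|%:R : R.
have [m0|m0] := eqVneq m 0.
  have /card0_eq T0 : #|T| = 0%N by apply/eqP; rewrite -(eqr_nat R) -/m m0.
  rewrite /S big_pred0 => [|t]; first by rewrite expr0n m0 mul0r.
  by move: (T0 t); rewrite inE.
have mp : 0 < m by rewrite lt0r m0 ler0n.
have : 0 <= \sum_t (m * (if P t then h t else 0) - S) ^+ 2.
  by apply: sumr_ge0 => t _; rewrite sqr_ge0.
have -> : \sum_t (m * (if P t then h t else 0) - S) ^+ 2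
  = m ^+ 2 * \sum_(t | P t) h t ^+ 2 - 2 * m * S * S + m * S ^+ 2.
  rewrite (eq_bigr (fun t => m ^+ 2 * (if P t then h t ^+ 2 else 0)
     - 2 * m * S * (if P t then h t else 0) + S ^+ 2)); last first.
    by move=> t _; case: ifP => _; ring.
  rewrite big_split sumrB /= sumr_const -[X in _ + X]mulr_natl.
  by rewrite -!mulr_sumr -!big_mkcond.
have le : \sum_(t | P t) h t ^+ 2 <= \sum_t h t ^+ 2.
  by rewrite big_mkcond ler_sum // => t _; case: ifP => // _; rewrite sqr_ge0.
move=> ge0.
have : 0 <= m * (m * \sum_(t | P t) h t ^+ 2 - S ^+ 2).
  by apply: (le_trans ge0); rewrite le_eqVlt; apply/orP; left; apply/eqP; ring.
rewrite pmulr_rge0 // subr_ge0 => /le_trans; apply.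
by rewrite ler_wpM2l // ltW.
Qed.

(** * Energy increments and regular partitions *)

Section Regularity.
Context (R : realFieldType).

Definition pcol (V : Type) (C : Type) (c : V -> C) (t : V * V) := (c t.1, c t.2).

Definition block (V : finType) (C : eqType) (c : V -> C) (M : V * V -> R) :=
  avg (pcol c) M.

Definition energy (V : finType) (C : eqType) (c : V -> C) (M : V * V -> R) :=
  \sum_t block c M t ^+ 2.

(** The lower half of closeness in cut norm; [W] will be a block average or a multiple of a dense
    graph. *)
Definition lower_regular (V : finType) (M W : V * V -> R) (d : R) :=
  forall A B : {set V}, \sum_(t in setX A B) W t - d <= \sum_(t in setX A B) M t.

Lemma pcol_refines (V : Type) (C C' : eqType) (c : V -> C) (c' : V -> C') :
  refines c' c -> refines (pcol c') (pcol c).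
Proof. by move=> r [x y] [x' y'] [/r ex /r ey]; rewrite /pcol /= ex ey. Qed.

(** If [A] and [B] violate regularity, refining by membership in both makes their rectangle a union
    of blocks. The block averages then sum over it to the true value, a change of more than [d],
    which Cauchy-Schwarz and Pythagoras turn into energy. *)
Lemma energy_incr (V : finType) (C : finType) (c : V -> C) (M : V * V -> R)
    (d : R) : 0 < d ->
  lower_regular M (block c M) d \/
  exists c' : V -> C * (bool * bool),
    refines c' c /\ energy c M * #|V|%:R ^+ 2 + d ^+ 2 <= energy c' M * #|V|%:R ^+ 2.
Proof.
move=> d0.
case: (boolP [forall A : {set V}, forall B : {set V},
  \sum_(t in setX A B) block c M t - d <= \sum_(t in setX A B) M t]) => [h|].
  by left=> A B; move/forallP/(_ A)/forallP/(_ B): h.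
case/forallPn => A /forallPn [B]; rewrite -ltNge => lt; right.
pose c' x := (c x, (x \in A, x \in B)); exists c'.
have r : refines c' c by move=> x y [].
split=> //.
have := sum_sqr_avg_sub M (pcol_refines r); rewrite -/(energy c M) -/(energy c' M).
have := sum_sqr_le (mem (setX A B)) (fun t => block c' M t - block c M t).
rewrite card_prod natrM /block => le e; rewrite e in le.
have inv : \sum_(t in setX A B) block c' M t = \sum_(t in setX A B) M t.
  rewrite !(big_mkcond (mem (setX A B))) /=.
  have := @sum_mul_avg R _ _ (pcol c') (fun t => (t \in setX A B)%:R) M.
  rewrite -/(block c' M) => /(_ _) e'.
  under eq_bigr => t _ do rewrite -mulrb -mulr_natl.
  under [RHS]eq_bigr => t _ do rewrite -mulrb -mulr_natl.
  by apply: e' => -[x y] [x' y']; rewrite /pcol /= !inE => -[_ -> _ _ _ ->].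
suff: d ^+ 2 <= (\sum_(t in setX A B) (block c' M t - block c M t)) ^+ 2.
  by move=> /le_trans /(_ le); lra.
by rewrite sumrB inv; nra.
Qed.

(** Each failure of regularity adds [d ^+ 2] to the scaled energy and multiplies the number of
    colours by 4; the ceiling [E] leaves room for fewer than [N] failures. *)
Lemma weak_regularity (V : finType) (M : V * V -> R) (d E : R) (N k : nat)
    (C : finType) (c : V -> C) :
    0 < d -> (#|C| <= k)%N ->
    (forall (C' : finType) (c' : V -> C'), (#|C'| <= 4 ^ N * k)%N ->
       energy c' M * #|V|%:R ^+ 2 <= E) ->
    E < energy c M * #|V|%:R ^+ 2 + N%:R * d ^+ 2 ->
  exists (C' : finType) (c' : V -> C'),
    [/\ (#|C'| <= 4 ^ N * k)%N, refines c' c & lower_regular M (block c' M) d].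
Proof.
move=> d0; elim: N k C c => [|N IH] k C c Ck bd lt.
  have := bd C c; rewrite expn0 mul1n => /(_ Ck).
  by rewrite mul0r addr0 in lt; rewrite leNgt lt.
have [reg|[c1 [r1 e1]]] := energy_incr c M d0.
  exists C, c; split => //.
  by apply: leq_trans Ck _; rewrite leq_pmull // expn_gt0.
have C1k : (#|{: C * (bool * bool)}| <= 4 * k)%N.
  by rewrite !card_prod !card_bool mulnC leq_mul.
have [| |C' [c' [k' r' reg]]] := IH (4 * k)%N _ c1 C1k.
- by move=> C' c' le; apply: bd; rewrite expnSr -mulnA.
- by move: lt; rewrite -natr1; lra.
exists C', c'; split=> //; first by rewrite expnSr -mulnA.
by move=> x y /r' /r1.
Qed.

End Regularity.

(* [c0] has size at most [k], while the finer [c1] is regular with an error that may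
   be arbitrarily small in terms of [k] but has almost the same energy as [c0]. *)
Lemma strong_regularity (R : archiRealFieldType) (b eta : R) (gam : nat -> R) :
    0 < eta -> (forall k, 0 < gam k) ->
  exists K : nat, forall (V : finType) (M : V * V -> R) (s : R),
    0 < s -> s ^+ 2 = #|V|%:R ->
    (forall (C : finType) (c : V -> C), (#|C| <= K)%N ->
       energy c M <= b * #|V|%:R) ->
  exists (k : nat) (C0 : finType) (c0 : V -> C0) (C1 : finType) (c1 : V -> C1),
    [/\ (#|C0| <= k <= K)%N, refines c1 c0,
        energy c1 M <= energy c0 M + eta * #|V|%:R &
        lower_regular M (block c1 M) (gam k * #|V|%:R * s)].
Proof.
move=> eta0 gam0.
(* [J] bounds the number of further energy increments [eta n]. *)
suff main (J k : nat) : exists K : nat, (k <= K)%N /\ forall (V : finType) (M : V * V -> R) (s : R),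
    0 < s -> s ^+ 2 = #|V|%:R ->
    (forall (C : finType) (c : V -> C), (#|C| <= K)%N ->
       energy c M <= b * #|V|%:R) ->
    forall (C : finType) (c : V -> C), (#|C| <= k)%N ->
    b * #|V|%:R < energy c M + J%:R * (eta * #|V|%:R) ->
  exists (k : nat) (C0 : finType) (c0 : V -> C0) (C1 : finType) (c1 : V -> C1),
    [/\ (#|C0| <= k <= K)%N, refines c1 c0,
        energy c1 M <= energy c0 M + eta * #|V|%:R &
        lower_regular M (block c1 M) (gam k * #|V|%:R * s)].
  (* The start is the one-class partition, of nonnegative energy; this many increments would lift it
     above [b n]. *)
  have [K [_ KP]] := main (Num.truncn (b / eta)).+1 1%N.
  exists K => V M s s0 sV bd; apply: (KP V M s s0 sV bd unit (fun=> tt)).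
    by rewrite card_unit.
  have e0 : 0 <= energy (fun _ : V => tt) M.
    by apply: sumr_ge0 => t _; rewrite sqr_ge0.
  have V0 : 0 < #|V|%:R :> R by rewrite -sV exprn_gt0.
  rewrite -[ltLHS]add0r ler_ltD // mulrA ltr_pM2r // -ltr_pdivrMr //.
  exact: truncnS_gt.
elim: J k => [|J IH] k.
  exists k; split=> // V M s s0 sV bd C c Ck.
  by rewrite mul0r addr0 ltNge bd.
(* As [s ^+ 2 = n], [N] cut refinements with error [gam k * n * s] would lift the energy above
   [b n]. *)
pose N := (Num.truncn (b / gam k ^+ 2)).+1.
have [K [kK KP]] := IH (4 ^ N * k)%N.
exists K; split.
  by apply: leq_trans kK; rewrite leq_pmull // expn_gt0.
move=> V M s s0 sV bd C c Ck lt.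
have V0 : 0 < #|V|%:R :> R by rewrite -sV exprn_gt0.
have d0 : 0 < gam k * #|V|%:R * s by rewrite !mulr_gt0.
have kK' : (k <= K)%N by apply: leq_trans kK; rewrite leq_pmull // expn_gt0.
have [| |C1 [c1 [C1k r1 reg]]] :=
  @weak_regularity _ V M _ (b * #|V|%:R * #|V|%:R ^+ 2) N k C c d0 Ck.
- move=> C' c' le; rewrite ler_pM2r ?exprn_gt0 //; apply: bd.
  exact: leq_trans le kK.
- have e0 : 0 <= energy c M by apply: sumr_ge0 => t _; rewrite sqr_ge0.
  have NP : b < N%:R * gam k ^+ 2.
    by rewrite -ltr_pdivrMr ?exprn_gt0 //; apply: truncnS_gt.
  rewrite !exprMn sV.
  have -> : N%:R * (gam k ^+ 2 * #|V|%:R ^+ 2 * #|V|%:R) =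
    (N%:R * gam k ^+ 2) * #|V|%:R * #|V|%:R ^+ 2 by ring.
  rewrite -[ltLHS]add0r ler_ltD ?mulr_ge0 ?sqr_ge0 //.
  by rewrite !ltr_pM2r ?exprn_gt0.
(* Either the regular refinement gained little energy and the pair is found, or it becomes the next
   coarse partition. *)
have [le|gt] := leP (energy c1 M) (energy c M + eta * #|V|%:R).
  by exists k, C, c, C1, c1; split=> //; rewrite Ck.
apply: (KP V M s s0 sV bd C1 c1 C1k).
by apply: lt_trans lt _; rewrite -natr1; lra.
Qed.

(** * From sets to bounded weights *)

Section WeightedSums.
Context (R : realFieldType) (V : finType).

(** A linear form on the unit cube is smallest at the indicator of its negative coefficients. *)
Lemma sum_mul_ge_neg (a f : V -> R) : (forall x, 0 <= a x <= 1) ->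
  \sum_(x in [set x | f x < 0]) f x <= \sum_x a x * f x.
Proof.
move=> a01; rewrite big_mkcond ler_sum // => x _.
by have := a01 x; rewrite inE; case: ltP; nra.
Qed.

Lemma ler_sum_mul_sub (a f h : V -> R) (d : R) : (forall x, 0 <= a x <= 1) ->
  0 <= d -> (forall x, f x - d <= h x) ->
  \sum_x a x * f x - #|V|%:R * d <= \sum_x a x * h x.
Proof.
move=> a01 d0 fh.
have -> : #|V|%:R * d = \sum_(x : V) d by rewrite sumr_const mulr_natl.
by rewrite -sumrB ler_sum // => x _; have := a01 x; have := fh x; nra.
Qed.

Lemma ler_sum_sub (f h : V -> R) (d : R) : (forall x, f x - d <= h x) ->
  \sum_x f x - #|V|%:R * d <= \sum_x h x.
Proof.
move=> fh; have -> : #|V|%:R * d = \sum_(x : V) d by rewrite sumr_const mulr_natl.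
by rewrite -sumrB ler_sum.
Qed.

Lemma ler_sum_const (f : V -> R) (d : R) : (forall x, f x <= d) ->
  \sum_x f x <= #|V|%:R * d.
Proof.
move=> fd; have -> : #|V|%:R * d = \sum_(x : V) d by rewrite sumr_const mulr_natl.
by rewrite ler_sum.
Qed.

Lemma bool01 (b : bool) : 0 <= (b%:R : R) <= 1.
Proof. by case: b; rewrite /= ?lexx ler01. Qed.

Lemma sum_setX (A B : {set V}) (F : V * V -> R) :
  \sum_(t in setX A B) F t = \sum_(x in A) \sum_(y in B) F (x, y).
Proof.
rewrite pair_big_dep /=; apply: eq_big => [[x y]|[x y] _] //.
by rewrite !inE.
Qed.

(** The difference of the two forms is linear in each weight, so it can be minimised at indicators
    of sets, one weight at a time; rescaling [b] costs the factor [m]. *)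
Lemma lower_regular_fun (M W : V * V -> R) (d m : R) (a b : V -> R) :
  lower_regular M W d -> 0 <= d -> 0 < m ->
  (forall x, 0 <= a x <= 1) -> (forall x, 0 <= b x <= m) ->
  \sum_x \sum_y a x * b y * W (x, y) - d * m <= \sum_x \sum_y a x * b y * M (x, y).
Proof.
move=> reg d0 m0 a01 bm.
pose K x y := M (x, y) - W (x, y).
have b01 y : 0 <= b y / m <= 1.
  by have /andP[? ?] := bm y; rewrite divr_ge0 ?(ltW m0) //= ler_pdivrMr ?mul1r.
have regK (A B : {set V}) : - d <= \sum_(x in A) \sum_(y in B) K x y.
  have := reg A B; rewrite !sum_setX /K.
  under [X in _ -> _ <= X]eq_bigr do rewrite sumrB.
  by rewrite sumrB; lra.
suff : - d <= \sum_x \sum_y a x * (b y / m) * K x y.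
  have -> : \sum_x \sum_y a x * (b y / m) * K x y =
     (\sum_x \sum_y a x * b y * M (x, y) - \sum_x \sum_y a x * b y * W (x, y)) / m.
    rewrite -sumrB mulr_suml; apply: eq_bigr => x _.
    rewrite -sumrB mulr_suml; apply: eq_bigr => y _.
    by rewrite /K; field; rewrite gt_eqF.
  by rewrite ler_pdivlMr //; lra.
pose L x := \sum_y (b y / m) * K x y.
have -> : \sum_x \sum_y a x * (b y / m) * K x y = \sum_x a x * L x.
  apply: eq_bigr => x _; rewrite /L mulr_sumr.
  by apply: eq_bigr => y _; rewrite [RHS]mulrA.
apply: le_trans (sum_mul_ge_neg L a01).
set A := [set x | _]; rewrite exchange_big /=.
under eq_bigr do rewrite -mulr_sumr.
apply: le_trans (sum_mul_ge_neg (fun y => \sum_(x in A) K x y) b01).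
by rewrite exchange_big /=; apply: regK.
Qed.

End WeightedSums.

(** * Codegrees and their excess *)

Section Codegree.
Context (V : finType).
Implicit Types (g : rel V) (x y : V).

Definition codeg g x y : nat := #|[pred z | g x z && g z y]|.

Lemma natr_codeg (R : realFieldType) g x y :
  (codeg g x y)%:R = \sum_z (g x z)%:R * (g z y)%:R :> R.
Proof.
rewrite /codeg -sum1_card natr_sum big_mkcond /=; apply: eq_bigr => z _.
by rewrite inE; case: (g x z) => /=; rewrite ?mul1r ?mul0r //; case: (g z y).
Qed.

(** The excess is thus exactly what truncating a codegree to 0/1 loses. *)
Lemma natr_codeg_pred (R : realFieldType) g x y :
  (codeg g x y).-1%:R = (codeg g x y)%:R - (0 < codeg g x y)%N%:R :> R.
Proof. by case: (codeg g x y) => [|m] /=; rewrite ?subr0 // -natr1 addrK. Qed.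

End Codegree.

(** * Counting lemma for closed 5-walks *)

Section Counting.
Context (R : realFieldType) (V : finType) (g U : rel V).

Let n : R := #|V|%:R.
Let G x y : R := (g x y)%:R.
Let H x y : R := (0 < codeg g x y)%N%:R.
Let W x y : R := (U x y)%:R.

(* Closed walks x - w - y - z - v - x: x is the apex, joined to the ends of the
   edge yz by 2-paths. *)
Definition pent (h : rel V) : R :=
  \sum_x \sum_w \sum_y \sum_v \sum_z
    (h x w)%:R * (h w y)%:R * (h y z)%:R * (h x v)%:R * (h v z)%:R.

Context (q d D e : R).
Hypothesis reg : lower_regular (fun t => (g t.1 t.2)%:R) (fun t => q * (U t.1 t.2)%:R) d.
Hypothesis d0 : 0 <= d.
Hypothesis q0 : 0 <= q.
Hypothesis D0 : 0 < D.
Hypothesis degD : forall x, \sum_y (g x y)%:R <= D.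
Hypothesis exc : forall x, \sum_y ((codeg g x y).-1)%:R <= e.

Let n0 : 0 <= n. Proof. exact: ler0n. Qed.

Let G01 x y : 0 <= G x y <= 1. Proof. exact: bool01. Qed.
Let W01 x y : 0 <= W x y <= 1. Proof. exact: bool01. Qed.
Let H01 x y : 0 <= H x y <= 1. Proof. exact: bool01. Qed.

Let reg_fun (m : R) (a b : V -> R) : 0 < m ->
  (forall x, 0 <= a x <= 1) -> (forall x, 0 <= b x <= m) ->
  q * (\sum_x \sum_y a x * b y * W x y) - d * m <= \sum_x \sum_y a x * b y * G x y.
Proof.
move=> m0 a01 bm; have := lower_regular_fun reg d0 m0 a01 bm; apply: le_trans.
rewrite lerD2r le_eqVlt; apply/orP; left; apply/eqP.
rewrite mulr_sumr; apply: eq_bigr => x _; rewrite mulr_sumr.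
by apply: eq_bigr => y _ /=; ring.
Qed.

Let reg_fun1 (a b : V -> R) :
  (forall x, 0 <= a x <= 1) -> (forall x, 0 <= b x <= 1) ->
  q * (\sum_x \sum_y a x * b y * W x y) - d <= \sum_x \sum_y a x * b y * G x y.
Proof. by move=> a01 b01; have := reg_fun ltr01 a01 b01; rewrite mulr1. Qed.

Let codegE x y : (codeg g x y)%:R = H x y + (codeg g x y).-1%:R.
Proof. by rewrite natr_codeg_pred /H; ring. Qed.

Let mul01 (a b : R) : 0 <= a <= 1 -> 0 <= b <= 1 -> 0 <= a * b <= 1.
Proof. nra. Qed.

Let sum_exc : \sum_x \sum_y ((codeg g x y).-1)%:R <= n * e.
Proof. exact: ler_sum_const. Qed.

(* Each step replaces one edge of [g] by [q * U], always against test functions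
   that are bounded independently of the sparsity. For this the 2-path counts
   [codeg] are first truncated to the 0/1 function [H], at the price of the excess
   [codeg - 1], and expanded again once their partner has become dense. *)
Let T0 := \sum_x \sum_y \sum_z (codeg g x y)%:R * (codeg g x z)%:R * G y z.
Let N0 := \sum_x \sum_y \sum_z H x y * H x z * W y z.
Let N1 := \sum_x \sum_y \sum_z (codeg g x y)%:R * H x z * W y z.
Let N2 := \sum_z \sum_x H x z * \sum_w \sum_y W x w * W y z * G w y.
Let N3 := \sum_z \sum_x H x z * \sum_w \sum_y W x w * W y z * W w y.
Let N4 := \sum_z \sum_x (codeg g x z)%:R * \sum_w \sum_y W x w * W y z * W w y.
Let N5 := \sum_w \sum_y W w y * \sum_x W x w * \sum_v \sum_z W x v * W y z * G v z.
Let N6 := \sum_w \sum_y W w y * \sum_x W x w * \sum_v \sum_z W x v * W y z * W v z.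

(** The edge yz is tested against the second neighbourhood of x on both sides; truncating the
    codegrees only lowers the count. *)
Let T0N0 : q * N0 - n * d <= T0.
Proof.
rewrite mulr_sumr; apply: ler_sum_sub => x.
apply: le_trans (reg_fun1 (H01 x) (H01 x)) _.
apply: ler_sum => y _; apply: ler_sum => z _.
have HC y' : H x y' <= (codeg g x y')%:R by rewrite ler_nat; case: (codeg _ _ _).
have := HC y; have := HC z; have := H01 x y; have := H01 x z; have := G01 y z.
move=> /andP[? _] /andP[? _] /andP[? _] ? ?.
by rewrite ler_wpM2r // ler_pM.
Qed.

Let N0N1 : N1 - n * (n * e) <= N0.
Proof.
rewrite lerBlDr -lerBlDl /N1 /N0 -sumrB.
apply: le_trans (_ : \sum_x \sum_y n * ((codeg g x y).-1)%:R <= _); last first.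
  under eq_bigr do rewrite -mulr_sumr.
  by rewrite -mulr_sumr ler_wpM2l.
apply: ler_sum => x _; rewrite -sumrB; apply: ler_sum => y _.
rewrite -sumrB; apply: ler_sum_const => z.
rewrite codegE; have := H01 x z; have := W01 y z.
have : 0 <= (codeg g x y).-1%:R :> R by [].
set c := _%:R; move=> c0 w01 h01.
have -> : (H x y + c) * H x z * W y z - H x y * H x z * W y z
  = c * (H x z * W y z) by ring.
by have /andP[_ p1] := mul01 h01 w01; rewrite -[leRHS]mulr1 ler_wpM2l.
Qed.

(** One codegree is reopened as a sum over w. The edge xw then meets a weight in w that counts some
    neighbours y of w, hence is at most [D]. *)
Let N1N2 : q * N2 - n * (d * D) <= N1.
Proof.
have -> : N1 = \sum_z \sum_x \sum_w H x z * (\sum_y W y z * G w y) * G x w.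
  rewrite /N1; under eq_bigr do rewrite exchange_big /=.
  rewrite exchange_big /=; apply: eq_bigr => z _; apply: eq_bigr => x _.
  under eq_bigr => y _ do rewrite natr_codeg !mulr_suml.
  rewrite exchange_big /=; apply: eq_bigr => w _.
  rewrite mulr_sumr mulr_suml; apply: eq_bigr => y _; rewrite /G; ring.
have -> : N2 = \sum_z \sum_x \sum_w H x z * (\sum_y W y z * G w y) * W x w.
  apply: eq_bigr => z _; apply: eq_bigr => x _.
  rewrite mulr_sumr; apply: eq_bigr => w _.
  rewrite !mulr_sumr mulr_suml; apply: eq_bigr => y _; ring.
rewrite mulr_sumr; apply: ler_sum_sub => z; apply: reg_fun => // w.
apply/andP; split; first by apply: sumr_ge0 => y _; rewrite mulr_ge0.
apply: le_trans (degD w); apply: ler_sum => y _.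
by have := W01 y z; have := G01 w y; nra.
Qed.

Let N2N3 : q * N3 - n * (n * d) <= N2.
Proof.
rewrite mulr_sumr; apply: ler_sum_sub => z; rewrite mulr_sumr.
under eq_bigr do rewrite mulrCA.
by apply: ler_sum_mul_sub => // x; apply: reg_fun1.
Qed.

Let N3N4 : N4 - n ^+ 2 * (n * e) <= N3.
Proof.
rewrite lerBlDr -lerBlDl /N4 /N3 -sumrB.
apply: le_trans (_ : \sum_z \sum_x n ^+ 2 * ((codeg g x z).-1)%:R <= _); last first.
  rewrite exchange_big /=.
  under eq_bigr do rewrite -mulr_sumr.
  by rewrite -mulr_sumr ler_wpM2l // sqr_ge0.
apply: ler_sum => z _; rewrite -sumrB; apply: ler_sum => x _.
rewrite codegE -mulrBl addrC addKr mulrC ler_wpM2r //.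
rewrite expr2; apply: ler_sum_const => w; rewrite -[leRHS]mulr1.
apply: ler_sum_const => y.
by have /andP[_] := mul01 (mul01 (W01 x w) (W01 y z)) (W01 w y).
Qed.

(** The other codegree is reopened over v, and the edge xv is replaced as xw was in [N1N2]. *)
Let N4N5 : q * N5 - n * (n * (d * D)) <= N4.
Proof.
have -> : N4 = \sum_w \sum_y W w y *
    \sum_x \sum_v W x w * (\sum_z W y z * G v z) * G x v.
  transitivity (\sum_z \sum_x \sum_v \sum_w \sum_y
      W x w * W y z * W w y * G v z * G x v).
    apply: eq_bigr => z _; apply: eq_bigr => x _.
    rewrite natr_codeg mulr_suml; apply: eq_bigr => v _.
    rewrite mulr_sumr; apply: eq_bigr => w _; rewrite mulr_sumr.
    by apply: eq_bigr => y _; rewrite /G; ring.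
  under eq_bigr => z _.
    under eq_bigr do rewrite exchange_big /=.
    rewrite exchange_big /=.
    under eq_bigr => w _.
      under eq_bigr do rewrite exchange_big /=.
      rewrite exchange_big /=.
      over.
    over.
  rewrite exchange_big /=; apply: eq_bigr => w _.
  rewrite exchange_big /=; apply: eq_bigr => y _.
  rewrite exchange_big /= mulr_sumr; apply: eq_bigr => x _.
  rewrite exchange_big /= mulr_sumr; apply: eq_bigr => v _.
  rewrite mulr_sumr mulr_suml mulr_sumr; apply: eq_bigr => z _; ring.
have -> : N5 = \sum_w \sum_y W w y *
    \sum_x \sum_v W x w * (\sum_z W y z * G v z) * W x v.
  apply: eq_bigr => w _; apply: eq_bigr => y _; congr (_ * _).
  apply: eq_bigr => x _; rewrite mulr_sumr; apply: eq_bigr => v _.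
  rewrite !mulr_sumr mulr_suml; apply: eq_bigr => z _; ring.
rewrite mulr_sumr; apply: ler_sum_sub => w; rewrite mulr_sumr.
under eq_bigr do rewrite mulrCA.
apply: ler_sum_mul_sub => //; first by rewrite mulr_ge0 // ltW.
move=> y; apply: reg_fun => // v.
apply/andP; split; first by apply: sumr_ge0 => z _; rewrite mulr_ge0.
apply: le_trans (degD v); apply: ler_sum => z _.
by have := W01 y z; have := G01 v z; nra.
Qed.

Let N5N6 : q * N6 - n * (n * (n * d)) <= N5.
Proof.
rewrite mulr_sumr; apply: ler_sum_sub => w; rewrite mulr_sumr.
under eq_bigr do rewrite mulrCA.
apply: ler_sum_mul_sub => // [|y]; first by rewrite mulr_ge0.
rewrite mulr_sumr; under eq_bigr do rewrite mulrCA.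
by apply: ler_sum_mul_sub => // x; apply: reg_fun1.
Qed.

Let N6E : N6 = pent U.
Proof.
rewrite /pent exchange_big /=; apply: eq_bigr => w _.
rewrite exchange_big /=; apply: eq_bigr => y _; rewrite mulr_sumr.
apply: eq_bigr => x _; rewrite mulrA mulr_sumr; apply: eq_bigr => v _.
rewrite mulr_sumr; apply: eq_bigr => z _; rewrite /W; ring.
Qed.

Let T0E : T0 = pent g.
Proof.
rewrite /pent /T0; apply: eq_bigr => x _.
rewrite [RHS]exchange_big /=; apply: eq_bigr => y _.
transitivity (\sum_w \sum_z \sum_v G x w * G w y * G y z * G x v * G v z); last first.
  by apply: eq_bigr => w _; rewrite exchange_big.
rewrite exchange_big /=; apply: eq_bigr => z _.
rewrite !natr_codeg !mulr_suml; apply: eq_bigr => w _.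
rewrite mulr_sumr mulr_suml; apply: eq_bigr => v _; rewrite /G; ring.
Qed.

(** The seven comparisons are chained: each of the five edge replacements gives a factor [q], and
    each of the two returns from [H] to codegrees an excess term. *)
Lemma pent_counting : q ^+ 5 * pent U -
    (n * d + q * n * (n * e) + q * n * (d * D) + q ^+ 2 * n ^+ 2 * d
     + q ^+ 3 * n ^+ 2 * (n * e) + q ^+ 3 * n ^+ 2 * d * D + q ^+ 4 * n ^+ 3 * d)
  <= pent g.
Proof.
rewrite -N6E -T0E.
have l0 := T0N0; have l1 := ler_wpM2l q0 N0N1; have l2 := ler_wpM2l q0 N1N2.
have q2 := exprn_ge0 2 q0; have q3 := exprn_ge0 3 q0; have q4 := exprn_ge0 4 q0.
have l3 := ler_wpM2l q2 N2N3; have l4 := ler_wpM2l q3 N3N4.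
have l5 := ler_wpM2l q3 N4N5; have l6 := ler_wpM2l q4 N5N6.
lra.
Qed.

End Counting.

(** * Energy of graphs with small codegree excess *)

Section GraphEnergy.
Context (R : realFieldType) (V C : finType) (c : V -> C).

(** Every nonempty class contributes exactly 1. *)
Lemma sum_inv_class_card : \sum_x (#|[pred y | c y == c x]|%:R)^-1 <= #|C|%:R :> R.
Proof.
rewrite (partition_big c xpredT) //= -sum1_card natr_sum; apply: ler_sum => i _.
rewrite (eq_bigr (fun=> (#|[pred y | c y == i]|%:R)^-1)) => [|x /eqP-> //].
rewrite sumr_const -[_ *+ _]mulr_natl.
have [e|ne] := eqVneq (#|[pred y | c y == i]|%:R : R) 0; last by rewrite divff.
by rewrite e invr0 mulr0.
Qed.

(* The squared row averages sum to averages of codegrees within the classes, which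
   exceed 1 only by the excess; hence the bound does not depend on the degrees. *)
Lemma energy_graph (g : rel V) (e : R) : symmetric g -> 0 <= e ->
  (forall x, \sum_y ((codeg g x y).-1)%:R <= e) ->
  energy c (fun t => (g t.1 t.2)%:R) <= #|V|%:R + #|C|%:R * e.
Proof.
move=> gs e0 exc.
pose G x y : R := (g x y)%:R; pose M (t : V * V) : R := G t.1 t.2.
rewrite -/M; pose W x y := block c M (x, y).
(* [S] averages over the first coordinate only. The block average is a further projection of it, so
   its norm is at most that of [S]. *)
pose S x y := avg c (G^~ y) x.
have pairE (F : V * V -> R) : \sum_t F t = \sum_y \sum_x F (x, y).
  by rewrite exchange_big /= pair_big /=; apply: eq_bigr => -[].
have E1 : energy c M = \sum_y \sum_x W x y * S x y.
  have /= := @sum_mul_avg R _ _ (pcol c) (block c M) M (@avg_refines _ _ _ _ _).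
  rewrite -/(block c M) => e1.
  transitivity (\sum_t block c M t * M t).
    by rewrite -e1; apply: eq_bigr => t _; rewrite expr2.
  rewrite pairE; apply: eq_bigr => y _.
  rewrite sum_mul_avg // => x x' xx'; apply: avg_refines.
  by rewrite /pcol /= xx'.
have E2 : energy c M = \sum_y \sum_x W x y ^+ 2 by rewrite /energy pairE.
have le : energy c M <= \sum_y \sum_x S x y ^+ 2.
  suff : 0 <= \sum_y \sum_x (W x y - S x y) ^+ 2.
    have -> : \sum_y \sum_x (W x y - S x y) ^+ 2 = energy c M
       - 2 * energy c M + \sum_y \sum_x S x y ^+ 2.
      rewrite [in X in _ - 2 * X]E1 E2 mulr_sumr -sumrB -big_split /=.
      apply: eq_bigr => y _; rewrite mulr_sumr -sumrB -big_split /=.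
      by apply: eq_bigr => x _; ring.
    lra.
  by apply: sumr_ge0 => y _; apply: sumr_ge0 => x _; rewrite sqr_ge0.
apply: le_trans le _.
have -> : \sum_y \sum_x S x y ^+ 2 =
    \sum_x (\sum_(x' | c x' == c x) (codeg g x x')%:R) / #|[pred y | c y == c x]|%:R.
  transitivity (\sum_y \sum_x S x y * G x y).
    apply: eq_bigr => y _; under eq_bigr do rewrite expr2.
    by rewrite sum_mul_avg //; apply: avg_refines.
  rewrite exchange_big /=; apply: eq_bigr => x _.
  transitivity (\sum_y \sum_(x' | c x' == c x) G x' y * G x y / #|[pred y | c y == c x]|%:R).
    by apply: eq_bigr => y _; rewrite /S /avg !mulr_suml; apply: eq_bigr => x' _; ring.
  rewrite exchange_big mulr_suml /=; apply: eq_bigr => x' _.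
  rewrite natr_codeg mulr_suml; apply: eq_bigr => y _.
  by rewrite [g y x']gs [_ * G x y]mulrC.
apply: le_trans (_ : \sum_x (1 + e * (#|[pred y | c y == c x]|%:R)^-1) <= _).
  apply: ler_sum => x _.
  have N0 := class_card_gt0 R c x.
  rewrite ler_pdivrMr // mulrDl mul1r divfK ?gt_eqF //.
  apply: le_trans (_ : \sum_(x' | c x' == c x) (1 + (codeg g x x').-1%:R) <= _).
    by apply: ler_sum => x' _; rewrite nat1r ler_nat; lia.
  rewrite big_split /= sumr_const lerD2l; apply: le_trans (exc x).
  by rewrite big_mkcond ler_sum // => x' _; case: ifP.
rewrite big_split /= sumr_const lerD2l -mulr_sumr mulrC.
by apply: ler_wpM2r => //; apply: sum_inv_class_card.
Qed.
End GraphEnergy.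

(** * Closed 5-walks through five dense pairs *)

Section PentLower.
Context (R : realFieldType) (V : finType).

Lemma ler_sum_subset (A : {set V}) (f F : V -> R) : (forall x, 0 <= F x) ->
  (forall x, x \in A -> f x <= F x) -> \sum_(x in A) f x <= \sum_x F x.
Proof.
move=> F0 fF; rewrite big_mkcond ler_sum // => x _.
by case: ifP => [/fF|].
Qed.

(** Union bound: each of the five pairs spoils at most a tenth of the 5-tuples, so at least half
    remain. *)
Lemma pent_lower (U : rel V) (X W Y Z S : {set V}) :
  let few (A B : {set V}) :=
    \sum_(x in A) \sum_(y in B) (~~ U x y)%:R <= #|A|%:R * #|B|%:R / 10 :> R in
  few X W -> few W Y -> few Y Z -> few X S -> few S Z ->
  #|X|%:R * #|W|%:R * #|Y|%:R * #|S|%:R * #|Z|%:R / 2 <= pent R U.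
Proof.
move=> few fXW fWY fYZ fXS fSZ.
pose N x y : R := (~~ U x y)%:R.
pose sum5 (F : V -> V -> V -> V -> V -> R) :=
  \sum_(x in X) \sum_(w in W) \sum_(y in Y) \sum_(v in S) \sum_(z in Z) F x w y v z.
have sum5B F F' : sum5 (fun x w y v z => F x w y v z - F' x w y v z) = sum5 F - sum5 F'.
  rewrite -sumrB; apply: eq_bigr => x _; rewrite -sumrB; apply: eq_bigr => w _.
  rewrite -sumrB; apply: eq_bigr => y _; rewrite -sumrB; apply: eq_bigr => v _.
  by rewrite sumrB.
have sumc (A : {set V}) (a : R) : \sum_(x in A) a = #|A|%:R * a.
  by rewrite sumr_const mulr_natl.
have s1 : sum5 (fun _ _ _ _ _ => 1) = #|X|%:R * #|W|%:R * #|Y|%:R * #|S|%:R * #|Z|%:R.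
  by rewrite /sum5 !sumc; ring.
have sXW : sum5 (fun x w _ _ _ => N x w) =
    #|Y|%:R * #|S|%:R * #|Z|%:R * \sum_(x in X) \sum_(w in W) N x w.
  rewrite mulr_sumr; apply: eq_bigr => x _; rewrite mulr_sumr.
  by apply: eq_bigr => w _; rewrite !sumc; ring.
have sWY : sum5 (fun _ w y _ _ => N w y) =
    #|X|%:R * #|S|%:R * #|Z|%:R * \sum_(w in W) \sum_(y in Y) N w y.
  rewrite /sum5 sumc -!mulrA; congr (_ * _); rewrite mulrA mulr_sumr.
  apply: eq_bigr => w _; rewrite mulr_sumr.
  by apply: eq_bigr => y _; rewrite !sumc; ring.
have sYZ : sum5 (fun _ _ y _ z => N y z) =
    #|X|%:R * #|W|%:R * #|S|%:R * \sum_(y in Y) \sum_(z in Z) N y z.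
  rewrite /sum5 !sumc -!mulrA; congr (_ * (_ * _)); rewrite mulr_sumr.
  by apply: eq_bigr => y _; rewrite sumc.
have sXS : sum5 (fun x _ _ v _ => N x v) =
    #|W|%:R * #|Y|%:R * #|Z|%:R * \sum_(x in X) \sum_(v in S) N x v.
  rewrite mulr_sumr; apply: eq_bigr => x _; rewrite !sumc -!mulrA.
  congr (_ * (_ * _)); rewrite mulr_sumr.
  by apply: eq_bigr => v _; rewrite sumc.
have sSZ : sum5 (fun _ _ _ v z => N v z) =
    #|X|%:R * #|W|%:R * #|Y|%:R * \sum_(v in S) \sum_(z in Z) N v z.
  by rewrite /sum5 !sumc; ring.
(* Pointwise, one minus the number of missing edges is at most the indicator of a closed walk. *)
apply: le_trans (_ : sum5 (fun x w y v z =>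
   1 - N x w - N w y - N y z - N x v - N v z) <= _).
  rewrite !sum5B s1 sXW sWY sYZ sXS sSZ.
  have p a b d : 0 <= a%:R * b%:R * d%:R :> R by rewrite -!natrM.
  have := ler_wpM2l (p #|Y| #|S| #|Z|) fXW.
  have := ler_wpM2l (p #|X| #|S| #|Z|) fWY.
  have := ler_wpM2l (p #|X| #|W| #|S|) fYZ.
  have := ler_wpM2l (p #|W| #|Y| #|Z|) fXS.
  have := ler_wpM2l (p #|X| #|W| #|Y|) fSZ.
  rewrite -/N; lra.
rewrite /sum5 /pent.
do 5! (apply: ler_sum_subset => [?|? _];
  first by repeat (apply: sumr_ge0 => ? _); rewrite -!natrM).
rewrite /N -!natrM; do 5! case: (U _ _) => /=; rewrite ?(mul1n, mul0n, muln0); lra.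
Qed.
End PentLower.

(** * Deleting the edges in small, sparse or non-uniform pairs *)

Section Cleaning.
Context (R : realFieldType) (V C0 C1 : finType) (c0 : V -> C0) (c1 : V -> C1).
Context (g : rel V) (s u theta tau D : R) (k : nat).

Let n : R := #|V|%:R.
Let M (t : V * V) : R := (g t.1 t.2)%:R.
Let W0 := block c0 M.
Let W1 := block c1 M.
Let cls x := [set y | c0 y == c0 x].
Let dev t := (W1 t - W0 t) ^+ 2.

Hypothesis g_sym : symmetric g.
Hypothesis s0 : 0 < s.
Hypothesis sn : s ^+ 2 = n.
Hypothesis u0 : 0 < u.
Hypothesis theta0 : 0 < theta.
Hypothesis tau0 : 0 < tau.
Hypothesis D0 : 0 < D.
Hypothesis degD : forall x, \sum_y (g x y)%:R <= D * s.
Hypothesis ref : refines c1 c0.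
Hypothesis en2 : energy c0 M <= 2 * n.
Hypothesis en_incr : energy c1 M <= energy c0 M + (u ^+ 2 * tau ^+ 2 / 5) * n.
Hypothesis C0k : (#|C0| <= k)%N.

Let small x := (#|cls x|%:R < theta * n / k.+1%:R).
Let low t := W0 t < 2 * u / s.
(** The threshold is a tenth of [(u / s) ^+ 2], as the Chebyshev bound in [few] requires. *)
Let bad t := u ^+ 2 / 10 / n < avg (pcol c0) dev t.
Let keep t := [&& ~~ small t.1, ~~ small t.2, ~~ low t & ~~ bad t].

Let n0 : 0 < n. Proof. by rewrite -sn exprn_gt0. Qed.
Let M01 t : 0 <= M t <= 1. Proof. exact: bool01. Qed.

Let cls_gt0 x : 0 < #|cls x|%:R :> R.
Proof. by rewrite ltr0n; apply/card_gt0P; exists x; rewrite inE. Qed.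

Let card_cls x : #|[pred y | c0 y == c0 x]| = #|cls x|.
Proof. by apply: eq_card => y; rewrite !inE. Qed.

(** The inverse class sizes sum to at most [k], and each small vertex has one above
    [k.+1 / (theta * n)]. *)
Let small_card : \sum_x (small x)%:R <= theta * n.
Proof.
have k0 : 0 < k.+1%:R :> R by rewrite ltr0n.
have t0 : 0 < theta * n / k.+1%:R by rewrite divr_gt0 // mulr_gt0.
apply: le_trans (_ : \sum_x theta * n / k.+1%:R * (#|[pred y | c0 y == c0 x]|%:R)^-1 <= _).
  apply: ler_sum => x _; rewrite card_cls /small; case: ltP => lt /=.
    by rewrite -[leLHS](divff (lt0r_neq0 (cls_gt0 x))) ler_pM2r ?invr_gt0 // ltW.
  by rewrite mulr_ge0 ?invr_ge0 // ltW.
rewrite -mulr_sumr; apply: le_trans (ler_wpM2l (ltW t0) (sum_inv_class_card R c0)) _.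
have -> : theta * n / k.+1%:R * #|C0|%:R = theta * n * (#|C0|%:R / k.+1%:R) by ring.
rewrite ler_piMr ?(mulr_ge0 (ltW theta0) (ltW n0)) // ltW // ltr_pdivrMr // mul1r ltr_nat ltnS.
exact: C0k.
Qed.

Let small_edges : \sum_t (small t.1)%:R * M t <= theta * D * n * s.
Proof.
rewrite -(pair_big xpredT xpredT (fun x y => (small x)%:R * M (x, y))) /=.
apply: le_trans (_ : \sum_x (small x)%:R * (D * s) <= _).
  by apply: ler_sum => x _; rewrite -mulr_sumr ler_wpM2l //; apply: degD.
rewrite -mulr_suml.
have := ler_wpM2r (ltW (mulr_gt0 D0 s0)) small_card; lra.
Qed.

Let swap_sum (F : V * V -> R) : \sum_t F (t.2, t.1) = \sum_t F t.
Proof.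
rewrite -(pair_big xpredT xpredT (fun x y => F (y, x))) exchange_big /= pair_big.
by apply: eq_bigr => -[].
Qed.

Let Mswap t : M (t.2, t.1) = M t.
Proof. by rewrite /M /= g_sym. Qed.

Let small_edges' : \sum_t (small t.2)%:R * M t <= theta * D * n * s.
Proof. by rewrite -swap_sum; under eq_bigr do rewrite Mswap. Qed.

Let sum_block (b : pred (V * V)) : refines (pcol c0) b ->
  \sum_t (b t)%:R * M t = \sum_t (b t)%:R * W0 t.
Proof. by move=> r; rewrite sum_mul_avg // => t t' /r ->. Qed.

Let card_VV : #|{: V * V}|%:R = n ^+ 2 :> R.
Proof. by rewrite card_prod natrM. Qed.

Let low_edges : \sum_t (low t)%:R * M t <= 2 * u * n * s.
Proof.
rewrite sum_block; last by move=> t t' e; rewrite /low /W0 /block (avg_refines _ e).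
apply: le_trans (_ : #|{: V * V}|%:R * (2 * u / s) <= _).
  apply: ler_sum_const => t; rewrite /low; case: ltP => lt /=; rewrite ?mul1r ?mul0r ?ltW //.
  by rewrite !mulr_gt0 ?invr_gt0.
rewrite card_VV expr2 -{2}sn.
by rewrite le_eqVlt; apply/orP; left; apply/eqP; field; rewrite gt_eqF.
Qed.

Let dev0 t : 0 <= dev t. Proof. exact: sqr_ge0. Qed.

(** Markov's inequality: by Pythagoras the total deviation is the energy gain from [c0] to [c1]. *)
Let bad_card : \sum_t (bad t)%:R <= 2 * tau ^+ 2 * n ^+ 2.
Proof.
have w0 : 0 < u ^+ 2 / 10 / n by rewrite !divr_gt0 ?exprn_gt0 // ltr0n.
rewrite -(ler_pM2l w0); apply: le_trans (_ : \sum_t dev t <= _).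
  rewrite -(sum_avg (pcol c0) dev) mulr_sumr; apply: ler_sum => t _.
  by case E: (bad t) => /=; [rewrite mulr1 ltW|rewrite mulr0 avg_ge0].
rewrite /dev /W1 /W0 /block sum_sqr_avg_sub; last exact: pcol_refines.
rewrite -/(energy c1 M) -/(energy c0 M) lerBlDl; apply: le_trans en_incr _.
rewrite lerD2l le_eqVlt; apply/orP; left; apply/eqP; field.
by rewrite gt_eqF.
Qed.

Let bad_edges : \sum_t (bad t)%:R * M t <= 2 * tau * n * s.
Proof.
rewrite sum_block; last by move=> t t' e; rewrite /bad (avg_refines _ e).
(* AM-GM: [2 W0 <= tau s W0^2 + 1 / (tau s)] *)
have ts0 : 0 < tau * s by rewrite mulr_gt0.
apply: le_trans (_ : \sum_t (tau * s / 2 * W0 t ^+ 2 + (bad t)%:R / (2 * (tau * s))) <= _).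
  apply: ler_sum => t _; case: (bad t); rewrite ?mul1r ?mul0r; last first.
    by rewrite addr0 mulr_ge0 ?sqr_ge0 // divr_ge0 // ltW.
  rewrite -subr_ge0.
  have -> : tau * s / 2 * W0 t ^+ 2 + (2 * (tau * s))^-1 - W0 t =
    (tau * s * W0 t - 1) ^+ 2 / (2 * (tau * s)).
    by field; rewrite !gt_eqF.
  by rewrite divr_ge0 ?sqr_ge0 // mulr_ge0 // ltW.
rewrite big_split /= -mulr_sumr -mulr_suml -/(energy c0 M).
have l1 : tau * s / 2 * energy c0 M <= tau * s / 2 * (2 * n).
  by rewrite ler_pM2l // divr_gt0.
have l2 : (\sum_t (bad t)%:R) / (2 * (tau * s)) <= (2 * tau ^+ 2 * n ^+ 2) / (2 * (tau * s)).
  by rewrite ler_pM2r // invr_gt0 mulr_gt0.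
have e3 : (2 * tau ^+ 2 * n ^+ 2) / (2 * (tau * s)) = tau * n * s.
  by rewrite -sn; field; rewrite !gt_eqF.
lra.
Qed.

Let keep_edges : \sum_t (~~ keep t)%:R * M t <= (2 * theta * D + 2 * u + 2 * tau) * n * s.
Proof.
apply: le_trans (_ : \sum_t ((small t.1)%:R * M t + (small t.2)%:R * M t
   + (low t)%:R * M t + (bad t)%:R * M t) <= _).
  apply: ler_sum => t _; rewrite -!mulrDl ler_wpM2r //.
  rewrite /keep -!natrD ler_nat.
  by case: (small _); case: (small _); case: (low _); case: (bad _).
rewrite !big_split /=.
have := small_edges; have := small_edges'; have := low_edges; have := bad_edges; lra.
Qed.

(** Asking for both orientations makes symmetry immediate and at most doubles the loss. *)
Let r x y := [&& g x y, keep (x, y) & keep (y, x)].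
Let U x y := u / s <= W1 (x, y).

(** Chebyshev: on a kept block [W0] is at least [2 * u / s], so a pair missing from [U] deviates by
    more than [u / s]. *)
Let few x y : keep (x, y) ->
  \sum_(x' in cls x) \sum_(y' in cls y) (~~ U x' y')%:R <=
  #|cls x|%:R * #|cls y|%:R / 10 :> R.
Proof.
case/and4P => _ _; rewrite -leNgt => W0xy; rewrite -leNgt.
have us0 : 0 < u / s by rewrite divr_gt0.
set N : R := #|[pred t' | pcol c0 t' == pcol c0 (x, y)]|%:R.
have N0 : 0 < N by apply: class_card_gt0.
have <- : N = #|cls x|%:R * #|cls y|%:R.
  rewrite -natrM -cardsX; congr _%:R; apply: eq_card => -[x' y'].
  by rewrite !inE /pcol /= xpair_eqE.
rewrite ler_pdivrMr // => le.
suff : (u / s) ^+ 2 * \sum_(x' in cls x) \sum_(y' in cls y) (~~ U x' y')%:R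
   <= u ^+ 2 / 10 / n * N.
  rewrite -sn => le2; rewrite -(ler_pM2l (exprn_gt0 2 us0)); apply: le_trans le2 _.
  by rewrite le_eqVlt; apply/orP; left; apply/eqP; field; rewrite gt_eqF.
apply: le_trans le.
rewrite -(sum_setX (cls x) (cls y) (fun t => (~~ U t.1 t.2)%:R)) mulr_sumr.
rewrite [leLHS](eq_bigl (fun t' => pcol c0 t' == pcol c0 (x, y))); last first.
  by case=> x' y'; rewrite !inE /pcol /= xpair_eqE.
apply: ler_sum => t /eqP e; rewrite /U -ltNge -surjective_pairing /dev.
case: ltP => lt; last by rewrite mulr0 sqr_ge0.
rewrite mulr1.
have : 2 * u / s <= W0 t by rewrite /W0 /block (avg_refines _ e).
nra.
Qed.

(** The five [c0]-classes along a surviving walk are large and joined by pairs almost complete in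
    [U], so [pent_lower] applies to them. *)
Lemma cleaning : exists r' : rel V,
  [/\ symmetric r', subrel r' g,
      \sum_x \sum_y (g x y && ~~ r' x y)%:R <= (4 * theta * D + 4 * u + 4 * tau) * n * s &
      forall x w y v z, r' x w -> r' w y -> r' y z -> r' x v -> r' v z ->
        (theta * n / k.+1%:R) ^+ 5 / 2 <= pent R (fun x y => u / s <= block c1 M (x, y))].
Proof.
exists r; split.
- by move=> x y; rewrite /r g_sym [keep (x, y) && _]andbC.
- by move=> x y /and3P[].
- rewrite pair_big /=.
  apply: le_trans (_ : \sum_t ((~~ keep t)%:R * M t + (~~ keep (t.2, t.1))%:R * M t) <= _).
    apply: ler_sum => -[x y] _; rewrite /r /M /=.
    by case: (g x y); case: (keep _); case: (keep _); rewrite /= ?mulr0 ?mulr1 ?addr0 ?add0r // lerDl.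
  rewrite big_split /=.
  have -> : \sum_t (~~ keep (t.2, t.1))%:R * M t = \sum_t (~~ keep t)%:R * M t.
    by rewrite -[RHS]swap_sum; under [RHS]eq_bigr do rewrite Mswap.
  have := keep_edges; lra.
move=> x w y v z /and3P[_ kxw _] /and3P[_ kwy _] /and3P[_ kyz _] /and3P[_ kxv _] /and3P[_ kvz _].
have := pent_lower (few kxw) (few kwy) (few kyz) (few kxv) (few kvz).
apply: le_trans; rewrite ler_pM2r ?invr_gt0 ?ltr0n //.
have big1 x' y' : keep (x', y') -> theta * n / k.+1%:R <= #|cls x'|%:R.
  by case/and4P => + _ _ _; rewrite -leNgt.
have big2 x' y' : keep (x', y') -> theta * n / k.+1%:R <= #|cls y'|%:R.
  by case/and4P => _ + _ _; rewrite -leNgt.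
have t0 : 0 <= theta * n / k.+1%:R by rewrite divr_ge0 // mulr_ge0 // ltW.
rewrite !exprSr expr0 mul1r.
have m2 := ler_pM t0 t0 (big1 _ _ kxw) (big2 _ _ kxw).
have m3 := ler_pM (mulr_ge0 t0 t0) t0 m2 (big2 _ _ kwy).
have m4 := ler_pM (mulr_ge0 (mulr_ge0 t0 t0) t0) t0 m3 (big2 _ _ kxv).
exact: ler_pM (mulr_ge0 (mulr_ge0 (mulr_ge0 t0 t0) t0) t0) t0 m4 (big2 _ _ kvz).
Qed.

End Cleaning.

(** * Deleting the edges at vertices of large degree or excess *)

Section Precleaning.
Context (R : realFieldType) (V : finType) (g : rel V).
Hypothesis g_sym : symmetric g.

Let n : R := #|V|%:R.
Let deg x : R := \sum_y (g x y)%:R.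
Let exc x : R := \sum_y ((codeg g x y).-1)%:R.

(** Both sides count 2-walks, by their ends and by their midpoint. *)
Lemma sum_codeg : \sum_x \sum_y (codeg g x y)%:R = \sum_x deg x ^+ 2.
Proof.
transitivity (\sum_x \sum_z \sum_y (g x z)%:R * (g z y)%:R : R).
  apply: eq_bigr => x _; rewrite exchange_big /=; apply: eq_bigr => y _.
  exact: natr_codeg.
rewrite exchange_big /=; apply: eq_bigr => z _.
rewrite expr2 mulr_suml; apply: eq_bigr => x _; rewrite mulr_sumr.
by apply: eq_bigr => y _; rewrite g_sym.
Qed.

Lemma sum_deg_sqr : \sum_x deg x ^+ 2 <= n ^+ 2 + \sum_x exc x.
Proof.
rewrite -sum_codeg.
apply: le_trans (_ : \sum_(x : V) \sum_(y : V) (1 + (codeg g x y).-1%:R) <= _).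
  by apply: ler_sum => x _; apply: ler_sum => y _; rewrite nat1r ler_nat; lia.
under eq_bigr do rewrite big_split /= sumr_const.
by rewrite big_split /= sumr_const -mulr_natl expr2.
Qed.

(** A degree above [D * s] is at most [deg x ^+ 2 / (D * s)], and the squares sum to at most
    [5 * n ^+ 2]. The other deleted vertices have degree at most [D * s], and Markov's inequality
    for the excess bounds their number. *)
Lemma preclean (s D e1 e2 : R) : 0 < s -> s ^+ 2 = n -> 0 < D -> 0 < e1 ->
    e2 <= 4 -> \sum_x exc x <= e2 * n ^+ 2 ->
  exists g1 : rel V,
  [/\ symmetric g1, subrel g1 g,
      \sum_x \sum_y (g x y && ~~ g1 x y)%:R <= (10 / D + 2 * e2 * D / e1) * n * s,
      forall x, \sum_y (g1 x y)%:R <= D * s &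
      forall x, \sum_y ((codeg g1 x y).-1)%:R <= e1 * n].
Proof.
move=> s0 sn D0 e10 e24 X.
have n0 : 0 < n by rewrite -sn exprn_gt0.
pose B x := (D * s < deg x) || (e1 * n < exc x).
pose g1 x y := [&& g x y, ~~ B x & ~~ B y].
have sub : subrel g1 g by move=> x y /andP[].
have le1 x y : (g1 x y)%:R <= (g x y)%:R :> R.
  by rewrite ler_nat; case E: (g1 x y); rewrite // (sub _ _ E).
exists g1; split=> //.
- by move=> x y; rewrite /g1 g_sym [~~ B x && _]andbC.
- have S5 : \sum_x deg x ^+ 2 <= 5 * n ^+ 2.
    by apply: le_trans sum_deg_sqr _; have := sqr_ge0 n; nra.
  apply: le_trans (_ : \sum_x \sum_y ((g x y)%:R * (B x)%:R + (g x y)%:R * (B y)%:R) <= _).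
    apply: ler_sum => x _; apply: ler_sum => y _; rewrite -!natrM -natrD ler_nat /g1.
    by case: (g x y); case: (B x); case: (B y).
  have -> : \sum_x \sum_y ((g x y)%:R * (B x)%:R + (g x y)%:R * (B y)%:R)
     = 2 * \sum_x deg x * (B x)%:R :> R.
    under eq_bigr do rewrite big_split /=.
    rewrite big_split /= [X in _ + X]exchange_big /= mulr_natl mulr2n.
    congr (_ + _); apply: eq_bigr => x _; rewrite mulr_suml //.
    by apply: eq_bigr => y _; rewrite g_sym.
  have Ds0 : 0 < D * s by rewrite mulr_gt0.
  have en0 : 0 < e1 * n by rewrite mulr_gt0.
  have deg0 x : 0 <= deg x by apply: sumr_ge0.
  have exc0 x : 0 <= exc x by apply: sumr_ge0.
  have le : \sum_x deg x * (B x)%:R <=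
      (\sum_x deg x ^+ 2) / (D * s) + D * s / (e1 * n) * \sum_x exc x.
    rewrite mulr_suml mulr_sumr -big_split /=; apply: ler_sum => x _.
    have p1 : 0 <= deg x ^+ 2 / (D * s) by rewrite divr_ge0 ?sqr_ge0 // ltW.
    have p2 : 0 <= D * s / (e1 * n) * exc x.
      by rewrite mulr_ge0 ?divr_ge0 // ltW.
    rewrite /B; have [lt|le] := ltP (D * s) (deg x) => /=.
      rewrite mulr1; apply: le_trans (_ : deg x ^+ 2 / (D * s) <= _); last by lra.
      by rewrite ler_pdivlMr // expr2 ler_wpM2l // ltW.
    have [lt|_] := ltP (e1 * n) (exc x) => /=; last by rewrite mulr0 addr_ge0.
    rewrite mulr1; apply: le_trans (_ : D * s / (e1 * n) * exc x <= _); last by lra.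
    apply: le_trans le _.
    rewrite -mulrA ler_peMr ?(ltW Ds0) // mulrC ler_pdivlMr // mul1r; exact: ltW.
  have l1 : (\sum_x deg x ^+ 2) / (D * s) <= 5 * n ^+ 2 / (D * s).
    by rewrite ler_pM2r ?invr_gt0.
  have l2 : D * s / (e1 * n) * \sum_x exc x <= D * s / (e1 * n) * (e2 * n ^+ 2).
    by rewrite ler_pM2l // divr_gt0.
  have q1 : 5 * n ^+ 2 / (D * s) = 5 / D * n * s.
    by rewrite -sn; field; rewrite !gt_eqF.
  have q2 : D * s / (e1 * n) * (e2 * n ^+ 2) = e2 * D / e1 * n * s.
    by field; rewrite !gt_eqF.
  have -> : (10 / D + 2 * e2 * D / e1) * n * s = 2 * (5 / D * n * s + e2 * D / e1 * n * s) by ring.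
  by rewrite -q1 -q2 ler_pM2l //; lra.
- move=> x; case E: (B x).
    rewrite big1 => [|y _]; first by rewrite mulr_ge0 // ltW.
    by rewrite /g1 E andbF.
  move/negbT: E; rewrite /B negb_or -!leNgt => /andP[le _].
  by apply: le_trans le; apply: ler_sum => y _; apply: le1.
- move=> x; case E: (B x).
    rewrite big1 => [|y _]; first by rewrite mulr_ge0 // ltW.
    by rewrite /codeg eq_card0 // => z; rewrite !inE /g1 E andbF.
  move/negbT: E; rewrite /B negb_or -!leNgt => /andP[_ le].
  apply: le_trans le; apply: ler_sum => y _; rewrite ler_nat.
  suff : (codeg g1 x y <= codeg g x y)%N by lia.
  apply: subset_leq_card; apply/subsetP => z; rewrite !inE.
  by move=> /andP[/sub -> /sub ->].
Qed.

(** The diagonal adds at most the degree sum [d], which is bounded in terms of itself: AM-GM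
    compares [2 * s * d] with the squared degrees, and these sum to at most [n ^+ 2 + Q + d]. *)
Lemma sum_exc_le (s Q : R) : 1 <= s -> s ^+ 2 = n -> 0 <= Q ->
  \sum_x \sum_(y | y != x) ((codeg g x y).-1)%:R <= Q ->
  \sum_x exc x <= 2 * Q + 2 * n * s.
Proof.
move=> s1 sn Q0 le; have s0 : 0 < s by apply: lt_le_trans s1.
pose d := \sum_x deg x.
have d0 : 0 <= d by apply: sumr_ge0 => x _; apply: sumr_ge0.
have X : \sum_x exc x <= Q + d.
  apply: le_trans (_ : \sum_x (\sum_(y | y != x) ((codeg g x y).-1)%:R + deg x) <= _); last first.
    by rewrite big_split lerD2r.
  apply: ler_sum => x _; rewrite /exc (bigD1 x) //= addrC lerD2l.
  apply: le_trans (_ : (codeg g x x)%:R <= _); first by rewrite ler_nat; lia.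
  rewrite natr_codeg; apply: ler_sum => y _; rewrite [g y x]g_sym.
  by case: (g x y); rewrite ?mulr1 ?mulr0.
have S := sum_deg_sqr.
have dS : 2 * s * d <= \sum_x deg x ^+ 2 + n * s ^+ 2.
  have -> : n * s ^+ 2 = \sum_(x : V) s ^+ 2 by rewrite sumr_const mulr_natl.
  rewrite mulr_sumr -big_split /=; apply: ler_sum => x _.
  by have := sqr_ge0 (deg x - s); rewrite sqrrB; lra.
suff : d <= 2 * n * s + Q by lra.
have : 2 * s * d <= n ^+ 2 + Q + d + n * s ^+ 2 by lra.
have -> : n ^+ 2 = n * s * s by rewrite -sn; ring.
(* Since [1 <= s], the [d] on the right is at most half of the left side. *)
move=> h; rewrite -(ler_pM2l s0).
nra.
Qed.

End Precleaning.

(** * Copies of cycles, labelled cycles and codegrees *)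

Lemma leq_card_inj (T T' : finType) (A : {pred T}) (B : {pred T'}) (f : T -> T') :
  {in A &, injective f} -> (forall x, x \in A -> f x \in B) -> (#|A| <= #|B|)%N.
Proof.
move=> fi fB; rewrite -(card_in_image fi); apply: subset_leq_card.
by apply/subsetP => _ /imageP[x xA ->]; apply: fB.
Qed.

Lemma leq_card_has (T : finType) (A : pred T) (qs : seq (pred T)) :
  (#|A| <= #|[pred p | A p && ~~ has (fun q : pred T => q p) qs]|
           + \sum_(q <- qs) #|[pred p | A p && q p]|)%N.
Proof.
elim: qs => [|q qs IH].
  by rewrite big_nil addn0; apply/eq_leq/eq_card => p; rewrite [RHS]inE /= andbT.
rewrite big_cons addnA; apply: leq_trans IH _; rewrite leq_add2r -cardUI.
apply: leq_trans (leq_addr _ _); apply: subset_leq_card; apply/subsetP => p.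
by rewrite !inE /=; case: (A p); case: (q p); case: (has _ _).
Qed.

Section Copies.
Context (V : finType) (E : {set {set V}}).

(** A map with a given edge set takes its values among the vertices covered by that set, of which
    there are at most [k]. *)
Lemma card_cycle_maps k :
  (#|[pred f : {ffun 'I_k -> V} | Defs.cycle_map E f]| <= k ^ k * #|copies k E|)%N.
Proof.
rewrite -[leqLHS]sum1_card (partition_big (@cyc_edges V k) (mem (copies k E))) /=; last first.
  by move=> f fE; apply/imsetP; exists f; rewrite ?inE.
rewrite mulnC -sum_nat_const; apply: leq_sum => S /imsetP[f0 _ S0].
rewrite sum1_card.
apply: leq_trans (_ : #|ffun_on (mem (cover S)) : pred {ffun 'I_k -> V}| <= _)%N.
  apply: subset_leq_card; apply/subsetP => f; rewrite !inE => /andP[_ /eqP Sf].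
  apply/ffun_onP => i; apply/bigcupP; exists [set f i; f (ordS i)]; last by rewrite !inE eqxx.
  by rewrite -Sf; apply/imsetP; exists i.
rewrite card_ffun_on card_ord.
suff le : (#|cover S| <= k)%N.
  by have [k0|k0] := posnP k; [rewrite k0 !expn0|rewrite leq_exp2r].
apply: leq_trans (_ : #|f0 @: 'I_k| <= _)%N; last first.
  by rewrite (leq_trans (leq_imset_card _ _)) // card_ord.
apply: subset_leq_card; apply/subsetP => v /bigcupP[A]; rewrite S0 => /imsetP[i _ ->].
by rewrite !inE => /orP[] /eqP->; apply: imset_f.
Qed.

Lemma cycle_map_tuple k (t : k.-tuple V) : uniq t ->
  (forall i, [set tnth t i; tnth t (ordS i)] \in E) ->
  Defs.cycle_map E [ffun i => tnth t i].
Proof.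
move=> ut tE; apply/andP; split; last by apply/forallP => i; rewrite !ffunE.
by apply/injectiveP => i j; rewrite !ffunE; apply/tuple_uniqP.
Qed.

Context (g : rel V).
Hypothesis gE : forall x y, g x y -> [set x; y] \in E.
Hypothesis g_sym : symmetric g.
Hypothesis g_irr : irreflexive g.

Let tup4 (x y z w : V) : 4.-tuple V := [tuple x; y; z; w].
Let tup5 (x y z v w : V) : 5.-tuple V := [tuple x; y; z; v; w].

Lemma cycle_map4 (x y z w : V) : uniq [:: x; y; z; w] ->
  g x y -> g y z -> g z w -> g w x -> Defs.cycle_map E [ffun i => tnth (tup4 x y z w) i].
Proof.
move=> u xy yz zw wx; apply: cycle_map_tuple => // i.
by case: i => [[|[|[|[|]]]]] //= i; rewrite !(tnth_nth x) /=; apply: gE.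
Qed.

Lemma cycle_map5 (x y z v w : V) : uniq [:: x; y; z; v; w] ->
  g x y -> g y z -> g z v -> g v w -> g w x ->
  Defs.cycle_map E [ffun i => tnth (tup5 x y z v w) i].
Proof.
move=> u xy yz zv vw wx; apply: cycle_map_tuple => // i.
by case: i => [[|[|[|[|[|]]]]]] //= i; rewrite !(tnth_nth x) /=; apply: gE.
Qed.

Lemma ffun_tnth_inj k : injective (fun t : k.-tuple V => [ffun i => tnth t i]).
Proof.
by move=> t t' /ffunP e; apply: eq_from_tnth => i; have := e i; rewrite !ffunE.
Qed.

(** For each pair one common neighbour is fixed; every other one closes a 4-cycle with it, and the
    labelled cycle determines the pair and that neighbour. *)
Lemma sum_codeg_le_copies :
  (\sum_x \sum_(y | y != x) (codeg g x y).-1 <= 4 ^ 4 * #|copies 4 E|)%N.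
Proof.
apply: leq_trans (card_cycle_maps 4).
(* The default [x] is harmless: without a common neighbour no [w] satisfies [B]. *)
pose z0 x y := odflt x [pick z | g x z && g z y].
pose B x y w := [&& y != x, g x w, g w y & w != z0 x y].
pose f (p : V * V * V) := [ffun i => tnth (tup4 p.1.1 (z0 p.1.1 p.1.2) p.1.2 p.2) i].
apply: leq_trans (_ : #|[pred p : V * V * V | B p.1.1 p.1.2 p.2]| <= _)%N; last first.
  apply: (@leq_card_inj _ _ _ _ f).
    move=> [[x y] w] [[x' y'] w'] _ _ /ffun_tnth_inj/(congr1 val) /=.
    by move=> [-> _ -> ->].
  move=> [[x y] w]; rewrite !inE /= => /and4P[yx xw wy wz].
  rewrite /f /= /z0 in wz *; case: pickP wz => [z /andP[xz zy]|/(_ w)]; last by rewrite xw wy.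
  move=> wz; apply: cycle_map4; rewrite 1?[g w _]g_sym 1?[g y _]g_sym //; last first.
  rewrite /= !inE andbT; have ne a b : g a b -> (a == b) = false.
    by case: eqP => // ->; rewrite g_irr.
  by rewrite !negb_or (ne x z) // (ne x w) // (ne z y) // [y == w]eq_sym (ne w y) // eq_sym yx eq_sym wz.
have -> : #|[pred p : V * V * V | B p.1.1 p.1.2 p.2]| = (\sum_x \sum_y \sum_w B x y w)%N.
  rewrite !pair_big -sum1_card big_mkcond /=; apply: eq_bigr => -[[x y] w] _.
  by rewrite inE /=; case: (B _ _ _).
apply: leq_sum => x _; rewrite [leqRHS](bigID (fun y => y != x)) /=.
apply: leq_trans (leq_addr _ _); apply: leq_sum => y yx.
have -> : (\sum_w B x y w)%N = #|[pred w | B x y w]|.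
  by rewrite -sum1_card [RHS]big_mkcond /=; apply: eq_bigr => w _; rewrite inE; case: (B _ _ _).
rewrite /B yx /codeg /z0.
case: pickP => [z xzy|no] /=; last by rewrite eq_card0.
rewrite (cardD1 z) inE xzy /=.
apply: subset_leq_card; apply/subsetP => w; rewrite !inE.
by case/and3P => -> -> ->.
Qed.

End Copies.

(** * Closed 5-walks against copies of C_5 *)

Section Walks.
Context (R : realFieldType) (V : finType) (g : rel V).
Hypothesis g_sym : symmetric g.

(** The coordinates follow the sums in [pent]; the cyclic order is x - w - y - z - v. *)
Definition walk5 (p : V * V * V * V * V) :=
  let: (x, w, y, v, z) := p in [&& g x w, g w y, g y z, g x v & g v z].

Lemma pent_card : pent R g = #|walk5|%:R.
Proof.
rewrite /pent !pair_big /= -sum1_card natr_sum [RHS]big_mkcond /=.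
apply: eq_bigr => -[[[[x w] y] v] z] _ /=; rewrite -!natrM !mulnb -!andbA.
by rewrite /in_mem /=; case: ifP.
Qed.

(* Every degenerate closed 5-walk is a triangle a - c - d with a pendant edge ab. *)
Definition lollipop (p : V * V * V * V) :=
  let: (a, b, c, d) := p in [&& g a b, g a c, g c d & g d a].

(** Each [a] has at most [D] pendant edges. Its triangles are counted by the codegrees along its
    edges, each at most 1 plus the excess, hence [D + e] in all. *)
Lemma card_lollipop (D e : R) : 0 <= D -> (forall x, \sum_y (g x y)%:R <= D) ->
  (forall x, \sum_y ((codeg g x y).-1)%:R <= e) ->
  #|lollipop|%:R <= D * (#|V|%:R * (D + e)).
Proof.
move=> D0 degD exc.
have -> : #|lollipop|%:R = \sum_a (\sum_b (g a b)%:R) * \sum_c (g a c)%:R * (codeg g c a)%:R :> R.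
  rewrite -sum1_card natr_sum big_mkcond /=.
  transitivity (\sum_a \sum_b \sum_c \sum_d (lollipop (a, b, c, d))%:R : R).
    rewrite !pair_big /=; apply: eq_bigr => -[[[a b] c] d] _.
    by rewrite /in_mem /=; case: ifP.
  apply: eq_bigr => a _; rewrite mulr_suml; apply: eq_bigr => b _.
  rewrite mulr_sumr; apply: eq_bigr => c _.
  rewrite natr_codeg !mulr_sumr; apply: eq_bigr => d _.
  by rewrite -!natrM !mulnb.
rewrite mulrCA; apply: ler_sum_const => a.
apply: ler_pM => //; try by do ?apply: sumr_ge0 => // *; rewrite -natrM.
apply: le_trans (lerD (degD a) (exc a)); rewrite -big_split /=.
apply: ler_sum => c _; rewrite [in leRHS](_ : codeg g a c = codeg g c a).
  by case: (g a c); rewrite ?mul1r ?mul0r ?nat1r ?ler_nat ?add0r //; lia.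
by apply: eq_card => d; rewrite !inE [g a d]g_sym [g d c]g_sym andbC.
Qed.

(** Without loops, a closed 5-walk either is a labelled 5-cycle or identifies one of the five
    nonconsecutive pairs listed in [eqs]. *)
Lemma pent_le_copies (E : {set {set V}}) (D e : R) : irreflexive g ->
    (forall x y, g x y -> [set x; y] \in E) -> 0 <= D ->
    (forall x, \sum_y (g x y)%:R <= D) ->
    (forall x, \sum_y ((codeg g x y).-1)%:R <= e) ->
  pent R g <= (5 ^ 5)%N%:R * #|copies 5 E|%:R + 5 * (D * (#|V|%:R * (D + e))).
Proof.
move=> g_irr gE D0 degD exc.
have L := card_lollipop D0 degD exc.
apply: le_trans (_ : (5 ^ 5 * #|copies 5 E| + 5 * #|lollipop|)%N%:R <= _); last first.
  by rewrite natrD !natrM lerD2l ler_wpM2l.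
rewrite pent_card ler_nat.
pose eqs : seq (pred (V * V * V * V * V)) := [::
  (fun p => let: (x, w, y, v, z) := p in x == y);
  (fun p => let: (x, w, y, v, z) := p in w == z);
  (fun p => let: (x, w, y, v, z) := p in y == v);
  (fun p => let: (x, w, y, v, z) := p in z == x);
  (fun p => let: (x, w, y, v, z) := p in v == w)].
apply: leq_trans (leq_card_has walk5 eqs) _; apply: leq_add.
  apply: leq_trans (card_cycle_maps _ 5).
  pose f (p : V * V * V * V * V) := let: (x, w, y, v, z) := p in
    [ffun i => tnth [tuple x; w; y; z; v] i].
  apply: (@leq_card_inj _ _ _ _ f).
    move=> [[[[x w] y] v] z] [[[[x' w'] y'] v'] z'] _ _ /ffun_tnth_inj/(congr1 val) /=.
    by move=> [-> -> -> -> ->].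
  move=> [[[[x w] y] v] z]; rewrite !inE /= => /andP[/and5P[xw wy yz xv vz]].
  rewrite !negb_or => /and5P[xy wz yv zx /andP[vw _]].
  apply: (cycle_map5 gE) => //; try by rewrite g_sym.
  rewrite /= !inE andbT; have ne a b : g a b -> (a == b) = false.
    by case: eqP => // ->; rewrite g_irr.
  by rewrite !negb_or (ne x w) // xy [x == z]eq_sym zx (ne x v) // (ne w y) // wz
    [w == v]eq_sym vw (ne y z) // yv [z == v]eq_sym (ne v z).
rewrite !big_cons big_nil addn0 !mulSn mul0n addn0.
(* In each case the repeated vertex becomes [a]: the vertex between its two occurrences is pendant,
   and the other three steps form the triangle. *)
apply: leq_add; last (apply: leq_add; last (apply: leq_add; last apply: leq_add)).
- apply: (@leq_card_inj _ _ _ _ (fun p => let: (x, w, y, v, z) := p in (x, w, z, v))).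
    move=> [[[[x w] y] v] z] [[[[x' w'] y'] v'] z'].
    by rewrite !inE => /andP[_ /eqP->] /andP[_ /eqP->] [-> -> -> ->].
  move=> [[[[x w] y] v] z]; rewrite !inE => /andP[/and5P[xw wy yz xv vz] /eqP ee]; subst.
  by rewrite /in_mem /=; apply/and4P; split=> //; rewrite g_sym.
- apply: (@leq_card_inj _ _ _ _ (fun p => let: (x, w, y, v, z) := p in (w, y, v, x))).
    move=> [[[[x w] y] v] z] [[[[x' w'] y'] v'] z'].
    by rewrite !inE => /andP[_ /eqP->] /andP[_ /eqP->] [-> -> -> ->].
  move=> [[[[x w] y] v] z]; rewrite !inE => /andP[/and5P[xw wy yz xv vz] /eqP ee]; subst.
  by rewrite /in_mem /=; apply/and4P; split=> //; rewrite g_sym.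
- apply: (@leq_card_inj _ _ _ _ (fun p => let: (x, w, y, v, z) := p in (y, z, x, w))).
    move=> [[[[x w] y] v] z] [[[[x' w'] y'] v'] z'].
    by rewrite !inE => /andP[_ /eqP->] /andP[_ /eqP->] [-> -> -> ->].
  move=> [[[[x w] y] v] z]; rewrite !inE => /andP[/and5P[xw wy yz xv vz] /eqP ee]; subst.
  by rewrite /in_mem /=; apply/and4P; split=> //; rewrite g_sym.
- apply: (@leq_card_inj _ _ _ _ (fun p => let: (x, w, y, v, z) := p in (z, v, w, y))).
    move=> [[[[x w] y] v] z] [[[[x' w'] y'] v'] z'].
    by rewrite !inE => /andP[_ /eqP->] /andP[_ /eqP->] [-> -> -> ->].
  move=> [[[[x w] y] v] z]; rewrite !inE => /andP[/and5P[xw wy yz xv vz] /eqP ee]; subst.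
  by rewrite /in_mem /=; apply/and4P; split=> //; rewrite g_sym.
- apply: (@leq_card_inj _ _ _ _ (fun p => let: (x, w, y, v, z) := p in (v, x, y, z))).
    move=> [[[[x w] y] v] z] [[[[x' w'] y'] v'] z'].
    by rewrite !inE => /andP[_ /eqP->] /andP[_ /eqP->] [-> -> -> ->].
  move=> [[[[x w] y] v] z]; rewrite !inE => /andP[/and5P[xw wy yz xv vz] /eqP ee]; subst.
  by rewrite /in_mem /=; apply/and4P; split=> //; rewrite g_sym.
Qed.

End Walks.

(** * Edge sets of symmetric relations *)

Section RelGraph.
Context (V : finType) (r : rel V).
Hypothesis r_sym : symmetric r.

Definition rel_edges : {set {set V}} :=
  [set [set p.1; p.2] | p in [pred p : V * V | r p.1 p.2]].

Lemma mem_rel_edges x y : ([set x; y] \in rel_edges) = r x y.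
Proof.
apply/imsetP/idP => [[[a b]]|rxy]; last by exists (x, y).
rewrite inE /= => rab e.
have xab : x \in [set a; b] by rewrite -e !inE eqxx.
have yab : y \in [set a; b] by rewrite -e !inE eqxx orbT.
have axy : a \in [set x; y] by rewrite e !inE eqxx.
have bxy : b \in [set x; y] by rewrite e !inE eqxx orbT.
move: xab yab axy bxy; rewrite !inE.
by do 4! (case/orP => /eqP ?); subst=> //; rewrite r_sym.
Qed.

Lemma copies_eq0 k : (forall f : {ffun 'I_k -> V}, ~ (forall i, r (f i) (f (ordS i)))) ->
  copies k rel_edges = set0.
Proof.
move=> no; apply/eqP/set0Pn => -[S /imsetP[f]]; rewrite inE => /andP[_ /forallP fE] _.
by apply: (no f) => i; rewrite -mem_rel_edges.
Qed.

(** Going once round a triangle and then back and forth along an edge is a closed 5-walk too. *)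
Lemma copies35_eq0 :
  (forall x w y v z, r x w -> r w y -> r y z -> r x v -> r v z -> False) ->
  copies 3 rel_edges = set0 /\ copies 5 rel_edges = set0.
Proof.
move=> no; split; apply: copies_eq0 => f fr.
  pose o (i : nat) := f (inord i).
  have e i : (i < 3)%N -> r (o i) (o (i.+1 %% 3)%N).
    move=> i3; have := fr (inord i); rewrite /o; congr (r _ (f _)).
    by apply: val_inj; rewrite /= !inordK // ltn_mod.
  have e01 : r (o 0%N) (o 1%N) := e 0%N isT.
  have e12 : r (o 1%N) (o 2%N) := e 1%N isT.
  have e20 : r (o 2%N) (o 0%N) := e 2%N isT.
  by apply: (no _ _ _ _ _ e01 e12 e20 e01); rewrite r_sym.
pose o (i : nat) := f (inord i).
have e i : (i < 5)%N -> r (o i) (o (i.+1 %% 5)%N).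
  move=> i5; have := fr (inord i); rewrite /o; congr (r _ (f _)).
  by apply: val_inj; rewrite /= !inordK // ltn_mod.
have e01 : r (o 0%N) (o 1%N) := e 0%N isT.
have e12 : r (o 1%N) (o 2%N) := e 1%N isT.
have e23 : r (o 2%N) (o 3%N) := e 2%N isT.
have e34 : r (o 3%N) (o 4%N) := e 3%N isT.
have e40 : r (o 4%N) (o 0%N) := e 4%N isT.
by apply: (no _ _ _ (o 4%N) _ e01 e12 e23); rewrite r_sym.
Qed.

Lemma card_setD_rel_edges (R : realFieldType) (E : {set {set V}}) :
  simple_graph E ->
  #|E :\: rel_edges|%:R <= \sum_x \sum_y (([set x; y] \in E) && ~~ r x y)%:R :> R.
Proof.
move=> simp.
apply: le_trans (_ : #|[pred p : V * V | ([set p.1; p.2] \in E) && ~~ r p.1 p.2]|%:R <= _).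
  rewrite ler_nat; apply: leq_trans (leq_imset_card (fun p : V * V => [set p.1; p.2]) _).
  apply: subset_leq_card; apply/subsetP => e; rewrite !inE => /andP[eF eE].
  have /eqP/cards2P[x [y [_ exy]]] := simp e eE; rewrite exy in eF eE *.
  by apply/imsetP; exists (x, y) => //; rewrite inE /= eE -mem_rel_edges.
rewrite pair_big /= -sum1_card natr_sum big_mkcond /= le_eqVlt; apply/orP; left.
by apply/eqP; apply: eq_bigr => -[x y] _; rewrite inE /=; case: ifP.
Qed.

End RelGraph.

(** * Choice of constants and conclusion *)

(** At these scales both sides are multiples of [s ^+ 5], with factors at most [3 * cK / 8] on the
    left and at least [5 * ck / 8] on the right. *)
Lemma counting_contradiction (R : realFieldType) (s u th D gam e1 del k ck cK : R) :
    0 < s -> 0 < u <= 1 -> 0 < th -> 1 <= D -> 0 < gam -> 0 < e1 -> 0 < k ->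
    ck = u ^+ 5 * th ^+ 5 / (2 * k ^+ 5) -> gam = ck / (4 * (3 + 2 * D)) ->
    0 < cK <= ck -> e1 <= cK / (40 * D) -> (5 ^ 5)%N%:R * del <= cK / 8 ->
    40 * D ^+ 2 / cK <= s ->
    forall n d q e Ds P : R, n = s ^+ 2 -> d = gam * n * s -> q = u / s ->
    e = e1 * n -> Ds = D * s -> P = (th * n / k) ^+ 5 / 2 ->
  (5 ^ 5)%N%:R * (del * (n ^+ 2 * s)) + 5 * (Ds * (n * (Ds + e))) <
  q ^+ 5 * P - (n * d + q * n * (n * e) + q * n * (d * Ds) + q ^+ 2 * n ^+ 2 * d
     + q ^+ 3 * n ^+ 2 * (n * e) + q ^+ 3 * n ^+ 2 * d * Ds + q ^+ 4 * n ^+ 3 * d).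
Proof.
move=> s0 /andP[u0 u1] th0 D1 g0 e0 k0 ckE gE /andP[cK0 cKk] e1le dle sle n d q e Ds P nE dE qE eE DsE PE.
have D0 : 0 < D by lra.
have -> : q ^+ 5 * P - (n * d + q * n * (n * e) + q * n * (d * Ds) + q ^+ 2 * n ^+ 2 * d
     + q ^+ 3 * n ^+ 2 * (n * e) + q ^+ 3 * n ^+ 2 * d * Ds + q ^+ 4 * n ^+ 3 * d)
  = s ^+ 5 * (ck - (gam * (1 + u * D + u ^+ 2 + u ^+ 3 * D + u ^+ 4) + e1 * (u + u ^+ 3))).
  rewrite ckE PE qE dE eE DsE nE; field.
  by rewrite !gt_eqF.
have -> : (5 ^ 5)%N%:R * (del * (n ^+ 2 * s)) + 5 * (Ds * (n * (Ds + e)))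
  = s ^+ 5 * ((5 ^ 5)%N%:R * del + 5 * D * e1 + 5 * D ^+ 2 / s).
  by rewrite DsE eE nE; field; rewrite gt_eqF.
rewrite ltr_pM2l ?exprn_gt0 //.
have b1 : 5 * D ^+ 2 / s <= cK / 8.
  rewrite ler_pdivrMr //; move: sle; rewrite ler_pdivrMr //; lra.
have b2 : 5 * D * e1 <= cK / 8.
  move: e1le; rewrite ler_pdivlMr ?mulr_gt0 //; lra.
have b3 : 2 * e1 <= cK / 8 by apply: le_trans b2; nra.
have u2 : u ^+ 2 <= 1 by rewrite exprn_ile1 // ltW.
have u3 : u ^+ 3 <= 1 by rewrite exprn_ile1 // ltW.
have u4 : u ^+ 4 <= 1 by rewrite exprn_ile1 // ltW.
have b4 : e1 * (u + u ^+ 3) <= cK / 8 by apply: le_trans b3; nra.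
have b5 : gam * (1 + u * D + u ^+ 2 + u ^+ 3 * D + u ^+ 4) <= gam * (3 + 2 * D).
  by rewrite ler_pM2l //; nra.
have b6 : gam * (3 + 2 * D) = ck / 4.
  by rewrite gE; field; rewrite gt_eqF //; lra.
lra.
Qed.

(** The square root enters as a parameter [s], so any archimedean field will do. The constants come
    in the order [D], [th], [u], [tau], [gam], [K], [e1], [e2], [del], [s0], each depending only on
    earlier ones. *)
Lemma removal (R : archiRealFieldType) (eps : R) : 0 < eps <= 1 ->
  exists (s0 delta : R), [/\ 0 < s0, 0 < delta &
    forall (V : finType) (s : R) (E : {set {set V}}),
      s0 <= s -> s ^+ 2 = #|V|%:R -> simple_graph E ->
      #|copies 5 E|%:R <= delta * (#|V|%:R ^+ 2 * s) ->
      #|copies 4 E|%:R <= delta * #|V|%:R ^+ 2 ->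
      exists F : {set {set V}},
        [/\ F \subset E, copies 3 F = set0, copies 5 F = set0 &
            #|E :\: F|%:R <= eps * (#|V|%:R * s)]].
Proof.
move=> /andP[eps0 eps1].
(* The budget of deleted edges: [eps / 4] through [D], [eps / 4] through [e2], and [eps / 6] through
   each of [th], [u] and [tau]. *)
pose D : R := 40 / eps.
have D40 : 40 <= D by rewrite /D ler_pdivlMr //; nra.
have D0 : 0 < D by lra.
have DE : 10 / D = eps / 4 by rewrite /D; field; rewrite gt_eqF.
have D1 : 1 <= D by lra.
clearbody D.
pose th : R := eps / (24 * D); pose u : R := eps / 24; pose tau : R := eps / 24.
have th0 : 0 < th by rewrite divr_gt0 // mulr_gt0.
have u0 : 0 < u by rewrite divr_gt0.
have u1 : u <= 1 by rewrite /u; lra.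
have tau0 : 0 < tau by rewrite divr_gt0.
(* [c k * s ^+ 5] is the main term of the count for at most [k] classes; it decreases in [k], so
   [c K] bounds [c k] from below for every [k] that occurs. *)
pose c (k : nat) : R := u ^+ 5 * th ^+ 5 / (2 * k.+1%:R ^+ 5).
have kS (k : nat) : 0 < 2 * k.+1%:R ^+ 5 :> R by rewrite mulr_gt0 // exprn_gt0 // ltr0n.
have uth : 0 < u ^+ 5 * th ^+ 5 by rewrite mulr_gt0 // exprn_gt0.
have c0 k : 0 < c k by rewrite divr_gt0.
have c_anti k k' : (k <= k')%N -> c k' <= c k.
  move=> kk'; rewrite /c ler_pM2l // lef_pV2 ?posrE //.
  by rewrite ler_pM2l // lerXn2r ?nnegrE // ler_nat.
pose gam (k : nat) : R := c k / (4 * (3 + 2 * D)).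
have gam0 k : 0 < gam k by rewrite divr_gt0 ?c0 // mulr_gt0 //; lra.
have eta0 : 0 < u ^+ 2 * tau ^+ 2 / 5 by rewrite divr_gt0 // mulr_gt0 // exprn_gt0.
have [K KP] := strong_regularity 2 eta0 gam0.
(* The first bound keeps the energy at most [2 * n] for up to [K] classes, the second makes the
   excess terms of the count small. *)
pose e1 : R := Num.min (K.+1%:R)^-1 (c K / (40 * D)).
have e10 : 0 < e1 by rewrite lt_min invr_gt0 ltr0n divr_gt0 // mulr_gt0.
have e1K : e1 <= K.+1%:R^-1 by rewrite ge_min lexx.
have e1c : e1 <= c K / (40 * D) by rewrite ge_min lexx orbT.
clearbody e1.
pose e2 : R := e1 * eps / (8 * D).
have e20 : 0 < e2 by apply: divr_gt0; apply: mulr_gt0.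
have e24 : e2 <= 4.
  have : e1 <= 1 by apply: le_trans e1K _; rewrite invf_le1 ?ltr0n // ler1n.
  move=> e11; have := mulr_ile1 (ltW e10) (ltW eps0) e11 eps1.
  by rewrite /e2 ler_pdivrMr ?mulr_gt0 //; lra.
have e2E : 2 * e2 * D / e1 = eps / 4 by rewrite /e2; field; rewrite !gt_eqF.
clearbody e2.
(* The first bound is for the copies of C_5; the second keeps the off-diagonal excess within half of
   [e2 * n ^+ 2]. *)
pose del : R := Num.min (c K / (8 * (5 ^ 5)%N%:R)) (e2 / (4 * (4 ^ 4)%N%:R)).
have p5 : 0 < (5 ^ 5)%N%:R :> R by rewrite ltr0n expn_gt0.
have p4 : 0 < (4 ^ 4)%N%:R :> R by rewrite ltr0n expn_gt0.
have del0 : 0 < del.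
  by rewrite lt_min; apply/andP; split; apply: divr_gt0 => //; apply: mulr_gt0.
have del5 : (5 ^ 5)%N%:R * del <= c K / 8.
  rewrite mulrC -ler_pdivlMr //; apply: le_trans (_ : c K / (8 * (5 ^ 5)%N%:R) <= _).
    by rewrite ge_min lexx.
  by rewrite invfM mulrA.
have del4 : (4 ^ 4)%N%:R * del <= e2 / 4.
  rewrite mulrC -ler_pdivlMr //; apply: le_trans (_ : e2 / (4 * (4 ^ 4)%N%:R) <= _).
    by rewrite ge_min lexx orbT.
  by rewrite invfM mulrA.
clearbody del.
(* The second summand absorbs the diagonal excess, the third the part of the degenerate walks that
   comes from the degrees alone. *)
pose s0 : R := 1 + 4 / e2 + 40 * D ^+ 2 / c K.
have p1 : 0 < 4 / e2 by rewrite divr_gt0.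
have p2 : 0 < 40 * D ^+ 2 / c K by rewrite divr_gt0 // mulr_gt0 // exprn_gt0.
exists s0, del; split => //; first by rewrite /s0; lra.
move=> V s E s0s sn simp C5 C4; set n : R := #|V|%:R in sn C5 C4 *.
have s1 : 1 <= s by move: s0s; rewrite /s0; lra.
have se2 : 4 <= e2 * s by rewrite mulrC -ler_pdivrMr //; move: s0s; rewrite /s0; lra.
have sD : 40 * D ^+ 2 / c K <= s by move: s0s; rewrite /s0; lra.
have spos : 0 < s by lra.
have npos : 0 < n by rewrite -sn exprn_gt0.
pose g x y := [set x; y] \in E.
have g_sym : symmetric g by move=> x y; rewrite /g setUC.
have g_irr : irreflexive g.
  by move=> x; apply/negP => /simp; rewrite setUid cards1.
have X : \sum_x \sum_y ((codeg g x y).-1)%:R <= e2 * n ^+ 2.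
  have Q0 : 0 <= (4 ^ 4 * #|copies 4 E|)%N%:R :> R by [].
  apply: le_trans (sum_exc_le g_sym s1 sn Q0 _) _.
    have := sum_codeg_le_copies (fun x y => id) g_sym g_irr.
    rewrite -(ler_nat R) natr_sum => /(le_trans _) -> //.
    by apply: ler_sum => x _; rewrite natr_sum.
  rewrite -/n natrM.
  have l1 : (4 ^ 4)%N%:R * #|copies 4 E|%:R <= (4 ^ 4)%N%:R * (del * n ^+ 2).
    by rewrite ler_pM2l.
  have l2 : (4 ^ 4)%N%:R * del * n ^+ 2 <= e2 / 4 * n ^+ 2.
    by rewrite ler_pM2r ?exprn_gt0.
  have l3 : 4 * (n * s) <= e2 * n ^+ 2.
    have -> : e2 * n ^+ 2 = (e2 * s) * (n * s) by rewrite -sn; ring.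
    by rewrite ler_pM2r // mulr_gt0.
  lra.
have [g1 [g1_sym g1g del1 deg1 exc1]] := preclean g_sym spos sn D0 e10 e24 X.
have g1_irr : irreflexive g1 by move=> x; apply/negP => /g1g; rewrite g_irr.
pose M (t : V * V) : R := (g1 t.1 t.2)%:R.
have en (C : finType) (col : V -> C) : (#|C| <= K)%N -> energy col M <= 2 * n.
  move=> CK; have e1n : 0 <= e1 * n by rewrite mulr_ge0 // ltW.
  apply: le_trans (energy_graph col g1_sym e1n exc1) _; rewrite -/n.
  have : #|C|%:R * e1 <= 1.
    apply: le_trans (_ : K.+1%:R * e1 <= _).
      by rewrite ler_pM2r // ler_nat leqW.
    by rewrite -ler_pdivlMl ?ltr0n // mulr1.
  by nra.
have [k [C0 [col0 [C1 [col1 [/andP[C0k kK] ref en_incr reg]]]]]] := KP V M s spos sn en.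
have [r [r_sym rg1 del2 walk]] := cleaning g1_sym spos sn u0 th0 tau0 D0 deg1 ref
  (en _ col0 (leq_trans C0k kK)) en_incr C0k.
pose U x y := u / s <= block col1 M (x, y).
(* Block averages are nonnegative, so replacing them by [u / s] on [U] and 0 elsewhere only lowers
   them. *)
have regU : lower_regular (fun t => (g1 t.1 t.2)%:R) (fun t => u / s * (U t.1 t.2)%:R)
    (gam k * n * s).
  move=> A B; apply: le_trans (reg A B); rewrite lerD2r; apply: ler_sum => t _.
  rewrite /U -surjective_pairing.
  have [le|_] := leP (u / s) (block col1 M t); first by rewrite mulr1.
  by rewrite mulr0; apply: avg_ge0 => t'; rewrite ler0n.
have no x w y v z : r x w -> r w y -> r y z -> r x v -> r v z -> False.
  move=> xw wy yz xv vz; have := walk _ _ _ _ _ xw wy yz xv vz; rewrite -/n -/U => lb.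
  have d0 : 0 <= gam k * n * s by apply/ltW/mulr_gt0 => //; apply: mulr_gt0.
  have q0 : 0 < u / s by apply: divr_gt0.
  have Ds0 : 0 < D * s by rewrite mulr_gt0.
  have low := pent_counting regU d0 (ltW q0) Ds0 deg1 exc1.
  have g1E a b : g1 a b -> [set a; b] \in E by move/g1g.
  have up := pent_le_copies g1_sym g1_irr g1E (ltW Ds0) deg1 exc1.
  have k0 : 0 < k.+1%:R :> R by rewrite ltr0n.
  have u01 : 0 < u <= 1 by rewrite u0.
  have cc : 0 < c K <= c k by rewrite c0 c_anti.
  have := counting_contradiction spos u01 th0 D1 (gam0 k) e10 k0 erefl erefl cc e1c del5 sD
    (esym sn) erefl erefl erefl erefl erefl.
  apply/negP; rewrite -leNgt.
  have l1 : (u / s) ^+ 5 * ((th * n / k.+1%:R) ^+ 5 / 2) <= (u / s) ^+ 5 * pent R U.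
    by rewrite ler_pM2l // exprn_gt0.
  have l2 : (5 ^ 5)%N%:R * #|copies 5 E|%:R <= (5 ^ 5)%N%:R * (del * (n ^+ 2 * s)).
    by rewrite ler_pM2l.
  rewrite -/n in low up.
  apply: le_trans (le_trans up (_ : _ <= _)); last by rewrite lerD2r.
  by apply: le_trans low; rewrite lerD2r.
have [F3 F5] := copies35_eq0 r_sym no.
exists (rel_edges r); split=> //.
  apply/subsetP => f /imsetP[[x y]]; rewrite inE /= => rxy ->.
  exact: g1g (rg1 _ _ rxy).
apply: le_trans (card_setD_rel_edges r_sym R simp) _.
apply: le_trans (_ : \sum_x \sum_y ((g x y && ~~ g1 x y)%:R + (g1 x y && ~~ r x y)%:R) <= _).
  apply: ler_sum => x _; apply: ler_sum => y _; rewrite -natrD ler_nat.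
  by rewrite -/(g x y); case: (g x y); case: (g1 x y); case: (r x y).
under eq_bigr do rewrite big_split /=.
rewrite big_split /=; apply: le_trans (lerD del1 del2) _.
rewrite -/n -mulrDl -mulrDl -mulrA ler_pM2r ?mulr_gt0 //.
have thE : 4 * th * D = eps / 6 by rewrite /th; field; rewrite gt_eqF.
by rewrite DE e2E thE /u /tau; lra.
Qed.

Theorem theorem1p2 (R : realType) (eps : R) (heps : 0 < eps) :
  exists (n0 : nat) (delta : R), 0 < delta /\
    forall n : nat, (n0 <= n)%N ->
    forall E : {set {set 'I_n}}, simple_graph E ->
      (#|copies 5 E|%:R <= delta * (n%:R ^+ 2 * Num.sqrt n%:R)) ->
      (#|copies 4 E|%:R <= delta * n%:R ^+ 2) ->
      exists F : {set {set 'I_n}},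
        [/\ F \subset E,
            copies 3 F = set0,
            copies 5 F = set0 &
            #|E :\: F|%:R <= eps * (n%:R * Num.sqrt n%:R)].
Proof.
have m01 : 0 < Num.min eps 1 <= 1 by rewrite lt_min heps ltr01 ge_min lexx orbT.
have [s0 [del [s00 del0 H]]] := removal m01.
(* From this [n0] on the square root of [n] is at least [s0]. *)
exists (Num.truncn (s0 ^+ 2)).+1, del; split=> // n nn E simp C5 C4.
have s0n : s0 <= Num.sqrt n%:R.
  rewrite -(ger0_norm (ltW s00)) -sqrtr_sqr ler_sqrt ?ler0n //.
  by apply/ltW/(lt_le_trans (truncnS_gt _)); rewrite ler_nat.
have sn : Num.sqrt n%:R ^+ 2 = #|'I_n|%:R :> R by rewrite sqr_sqrtr // card_ord.
have [|| F [FE F3 F5 EF]] := H 'I_n _ E s0n sn simp; rewrite ?card_ord //.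
exists F; split=> //; apply: le_trans EF _.
rewrite card_ord ler_wpM2r ?mulr_ge0 ?sqrtr_ge0 //.
by rewrite ge_min lexx.
Qed.
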